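(* Let $\overline{\mathbb{G}}$ be an infinite connected graph of bounded degrees, $c\ge1$ and integers $N(k)\ge1$, $k\ge1$. With $\overline{\mathbb{B}}_k:=\mathbb{B}^{\overline{\mathbb{G}}}(0,ck)$ and $\mathcal{C}_k:=\{x\in\overline{\mathbb{B}}_k:\ d^{\overline{\mathbb{G}}}(x,\partial\overline{\mathbb{B}}_k)=1\}$: if $$\sum_{k=1}^\infty N(k)\inf_{x\in\mathcal{C}_k}\mathbb{P}_x\big(\text{simple random walk on }\overline{\mathbb{G}}\text{ hits }0\text{ before }\partial\overline{\mathbb{B}}_k\big)=\infty,$$ then the sample path of the corresponding expanding glassy spheres (EGS) interaction is a.s. recurrent; whereas if $$\sum_{k=1}^\infty N(k)\sup_{x\in\mathcal{C}_k}\mathbb{P}_x\big(\text{simple random walk on }\overline{\mathbb{G}}\text{ hits }0\text{ before }\partial\overline{\mathbb{B}}_{k+1}\big)<\infty,$$ then the sample path of the corresponding EGS is a.s. transient. In particular, for $\overline{\mathbb{G}}=\mathbb{Z}^d$, $d\ge2$ (with the EGS defined via projected Euclidean balls), there is a zero-one law for transience/recurrence of the EGS sample path, which is a.s. transient if and only if $$\sum_{k=1}^\infty N(k)\,k^{1-d}<\infty$$ (and is otherwise a.s. recurrent).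
   Context: For a connected, locally finite infinite graph $\overline{\mathbb{G}}$ with distinguished vertex $0$: $d^{\overline{\mathbb{G}}}$ is the graph distance, $\mathbb{B}^{\overline{\mathbb{G}}}(z,r)$ the closed ball of radius $r$ and center $z$, viewed as the induced subgraph of $\overline{\mathbb{G}}$. For a subgraph $\mathbb{G}\subseteq\overline{\mathbb{G}}$, $\partial\mathbb{G}:=\{z\in\mathbb{G}:\deg_{\mathbb{G}}(z)<\deg_{\overline{\mathbb{G}}}(z)\}$. $\mathbb{P}_x$ denotes the law of the walk started at $x$. Expanding glassy spheres (EGS) interaction, with parameters $c\ge1$ and $N(k)\ge1$: it is the simple random walk $\{Z_t\}$ on the growing graphs $\mathbb{G}_t=\overline{\mathbb{B}}_k$ for $t\in[\tau_k,\tau_{k+1})$, starting at $Z_0=0$ (given the past up to time $t$, $Z_{t+1}$ is uniform among the neighbors of $Z_t$ in $\mathbb{G}_t$), where $\tau_1:=0$ and $$\tau_{k+1}:=\inf\Big\{s>\tau_k:\ \sum_{t=\tau_k}^{s-1}\mathbf{1}\{Z_t\in\partial\overline{\mathbb{B}}_k\}=N(k)\Big\},\qquad k\ge1 .$$ For $\overline{\mathbb{G}}=\mathbb{Z}^d$ the EGS is instead defined with $\overline{\mathbb{B}}_k$ replaced by the projected Euclidean ball $\mathbb{B}_{ck}$, where $\mathbb{B}_r$ is the set of points of $\mathbb{Z}^d$ in the closed Euclidean ball of radius $r$ centered at the origin (as an induced subgraph of $\mathbb{Z}^d$): the walk is confined to $\mathbb{B}_{ck}$ until making the prescribed number $N(k)$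 of visits to its boundary, at which time the domain expands to $\mathbb{B}_{c(k+1)}$, and so on. The sample path is recurrent if $Z_t=0$ for infinitely many $t$, and transient otherwise. *)

(* Defs.v *)
From HB Require Import structures.
From mathcomp Require Import all_boot all_order all_algebra finmap.
From mathcomp Require Import all_classical all_reals all_analysis.

Set Implicit Arguments.
Unset Strict Implicit.
Unset Printing Implicit Defensive.

Import Order.TTheory GRing.Theory Num.Theory.
Import numFieldNormedType.Exports.

Local Open Scope classical_set_scope.
Local Open Scope ring_scope.

(* A graph is a symmetric irreflexive relation [e] on its vertices; a set [G]
   of vertices stands for the subgraph it induces. *)
Section Graph.
Variables (R : realType) (V : choiceType) (e : rel V).

Definition graph_connected : Prop :=
  forall x y : V, exists2 p : seq V, path e x p & last x p = y.

Definition neighbors (G : set V) (x : V) : set V := [set y | G y /\ e x y].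

Definition bounded_degrees : Prop :=
  exists D : nat, forall x : V, (neighbors setT x #<= `I_D)%card.

Definition degree (G : set V) (x : V) : nat :=
  #|` fset_set (neighbors G x)|%fset.

Definition graph_boundary (G : set V) : set V :=
  [set z | G z /\ (degree G z < degree setT z)%N].

Definition graph_dist (x y : V) : \bar R :=
  ereal_inf [set (size p)%:R%:E | p in [set p | path e x p /\ last x p = y]].

Definition graph_dist_set (x : V) (A : set V) : \bar R :=
  ereal_inf [set graph_dist x y | y in A].

Definition graph_ball (z : V) (r : R) : set V :=
  [set x | (graph_dist z x <= r%:E)%E].

Definition unif_step (G : set V) (x y : V) : R :=
  if y \in neighbors G x then (degree G x)%:R^-1 else 0.

End Graph.

(* [Z] starts at [x0] and, given its past [z 0, ..., z t] (of positive
   probability) up to time [t], [Z t.+1] is uniform among the neighbors of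
   [z t] in [G z t]. The domain [G z t] is meant to depend on [z] only through
   [z 0, ..., z t]. *)
Definition walk_on_domains (R : realType) (V : choiceType) (e : rel V)
    (G : (nat -> V) -> nat -> set V) (x0 : V)
    (d : measure_display) (T : measurableType d) (P : probability T R)
    (Z : nat -> T -> V) : Prop :=
  [/\ forall (t : nat) (A : set V), measurable (Z t @^-1` A),
      P [set w | Z 0%N w = x0] = 1%E &
      forall (z : nat -> V) (t : nat),
        P [set w | forall s, (s <= t.+1)%N -> Z s w = z s] =
        (P [set w | forall s, (s <= t)%N -> Z s w = z s] *
         (unif_step R e (G z t) (z t) (z t.+1))%:E)%E].

Definition simple_random_walk (R : realType) (V : choiceType) (e : rel V)
    (x0 : V) (d : measure_display) (T : measurableType d)
    (P : probability T R) (Z : nat -> T -> V) : Prop :=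
  walk_on_domains e (fun _ _ => setT) x0 P Z.

(* [None] is the infimum +oo of the empty set. *)
Definition nat_inf (A : set nat) : option nat :=
  match pselect (exists n, n \in A) with
  | left exA => Some (ex_minn exA)
  | right _ => None
  end.

Section EGS.
Variables (V : choiceType) (e : rel V) (B : nat -> set V) (N : nat -> nat).

(* The times tau_k, k >= 1, of a path [z], [None] being +oo; the value at
   k = 0 is irrelevant. *)
Fixpoint egs_tau (z : nat -> V) (k : nat) : option nat :=
  match k with
  | 0 | 1 => Some 0%N
  | k'.+1 =>
      if egs_tau z k' is Some u then
        nat_inf [set s | (u < s)%N /\
          (\sum_(u <= t < s) (z t \in graph_boundary e (B k')))%N = N k']
      else None
  end.

Definition egs_stage (z : nat -> V) (t k : nat) : Prop :=
  [/\ (1 <= k)%N,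
      exists2 u, egs_tau z k = Some u & (u <= t)%N &
      forall v, egs_tau z k.+1 = Some v -> (t < v)%N].

(* Exactly one [k] satisfies [egs_stage z t k], hence this is [B k] for that
   [k]. *)
Definition egs_domain (z : nat -> V) (t : nat) : set V :=
  \bigcup_(k in egs_stage z t) B k.

Definition EGS (R : realType) (o : V) (d : measure_display)
    (T : measurableType d) (P : probability T R) (Z : nat -> T -> V) : Prop :=
  walk_on_domains e egs_domain o P Z.

End EGS.

Definition recurrent_path (V : Type) (o : V) (z : nat -> V) : Prop :=
  infinite_set [set t | z t = o].

Definition transient_path (V : Type) (o : V) (z : nat -> V) : Prop :=
  ~ recurrent_path o z.

Definition as_recurrent (R : realType) (V : Type) (o : V)
    (d : measure_display) (T : measurableType d) (P : probability T R)
    (Z : nat -> T -> V) : Prop :=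
  {ae P, forall w, recurrent_path o (Z ^~ w)}.

Definition as_transient (R : realType) (V : Type) (o : V)
    (d : measure_display) (T : measurableType d) (P : probability T R)
    (Z : nat -> T -> V) : Prop :=
  {ae P, forall w, transient_path o (Z ^~ w)}.

Definition hits_before (V : Type) (o : V) (A : set V) (z : nat -> V) : Prop :=
  exists2 t : nat, z t = o & forall s : nat, (s <= t)%N -> ~ A (z s).

Definition egs_ball (R : realType) (V : choiceType) (e : rel V) (o : V)
    (c : R) (k : nat) : set V :=
  graph_ball e o (c * k%:R).

Definition inner_shell (R : realType) (V : choiceType) (e : rel V) (o : V)
    (c : R) (k : nat) : set V :=
  [set x | egs_ball e o c k x /\
     graph_dist_set R e x (graph_boundary e (egs_ball e o c k)) = 1%E].

Definition Zd_adj (d : nat) : rel 'rV[int]_d :=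
  fun x y => \sum_(i < d) `|x ord0 i - y ord0 i| == 1.

Definition Zd_ball (R : realType) (d : nat) (r : R) : set 'rV[int]_d :=
  [set x | Num.sqrt (\sum_(i < d) (x ord0 i)%:~R ^+ 2) <= r].

(* Main.v *)
(* The EGS walk is a Markov chain once the current stage k and the number of
   boundary visits made in this stage are added to its state. Everything is read
   off nonnegative supermartingales and the maximal inequality.

   Recurrence: let g be bounded above, subharmonic off the target in the interior
   of the k-th domain, and increasing by at least p_k on average at a step from
   its boundary. Then, until the target is hit, C - g plus the p's accumulated at
   the boundary visits is a nonnegative supermartingale. It would tend to infinity
   if the target were avoided, since every stage ends and sum N(k) p_k = oo.

   Transience: let f >= 1 at the target be superharmonic off it, and let it
   increase by at most s_k at a step from the boundary. Then f plus the remaining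
   part of sum N(k) s_k is a supermartingale, and f is small on far boundaries.

   On a general graph, f and g are the hitting probabilities. On Z^d, f and g are
   (|x|^2 + e)^(-(d-2)/2), superharmonic for e large and subharmonic far from 0
   for -e large, and g = -ln(|x|^2 - 1) if d = 2. A step from the boundary of the
   Euclidean ball of radius r changes them by O(r^(1-d)), and g gains this order
   on average because the most outward neighbor is missing. For d = 2 the
   series always diverges, as N(k) >= 1. *)
Require Import Defs.
From HB Require Import structures.
From mathcomp Require Import all_boot all_order all_algebra finmap.
From mathcomp Require Import all_classical all_reals all_analysis.
From mathcomp Require Import zify ring lra.

Set Implicit Arguments.
Unset Strict Implicit.
Unset Printing Implicit Defensive.

Import Order.TTheory GRing.Theory Num.Theory.
Import numFieldNormedType.Exports.

Local Open Scope classical_set_scope.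
Local Open Scope ring_scope.

(** * Paths and laws of walks *)

(** The walk is specified only by its cylinder probabilities, and its domain depends on the whole
    past. Expectations are therefore iterated finite averages over the continuations of a history
    ([expect]); countability of the vertices turns the probability of every event decided by time n
    into such an average. The supermartingale property becomes a one-step inequality along histories
    of positive probability. Stopping is encoded by freezing a process once a target has been seen,
    so that only eventual lower bounds matter and Markov's inequality at fixed times suffices. That
    every stage ends almost surely is itself proved in this way, from a bounded function with
    positive drift in the interior. The functions f and g may change with the stage, so a step from
    a boundary is controlled twice: with the function of the current stage, and with that of the
    next one in case the visit is the last of its stage. *)

Definition update (V : Type) (z : nat -> V) (t : nat) (y : V) : nat -> V :=
  fun s => if s == t then y else z s.

Definition agree (V : Type) (n : nat) (z z' : nat -> V) : Prop :=
  forall s, (s <= n)%N -> z s = z' s.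

Definition adapted (V T : Type) (F : (nat -> V) -> nat -> T) : Prop :=
  forall n z z', agree n z z' -> F z n = F z' n.

Lemma update_same (V : Type) (z : nat -> V) t y : update z t y t = y.
Proof. by rewrite /update eqxx. Qed.

Lemma update_lt (V : Type) (z : nat -> V) t y s :
  (s < t)%N -> update z t y s = z s.
Proof. by rewrite /update => st; rewrite ltn_eqF. Qed.

Lemma agree_update (V : Type) (z : nat -> V) t y : agree t z (update z t.+1 y).
Proof. by move=> s st; rewrite update_lt. Qed.

Arguments agree_update {V} z t y.

Lemma agreeW (V : Type) m n (z z' : nat -> V) :
  (m <= n)%N -> agree n z z' -> agree m z z'.
Proof. by move=> mn zz' s sm; apply: zz'; exact: leq_trans sm mn. Qed.

Lemma le_prob_null (R : realType) (d : measure_display)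
    (T : measurableType d) (P : probability T R) (A B C : set T) :
  measurable A -> measurable B -> measurable C -> P C = 0 ->
  B `<=` A `|` C -> (P B <= P A)%E.
Proof.
move=> mA mB mC C0 BAC; apply: (@le_trans _ _ (P (A `|` C))).
  by apply: le_measure; rewrite ?inE//; exact: measurableU.
have : (P (A `|` C) <= P A + P C)%E by exact: measureU2.
by rewrite C0 adde0.
Qed.

Section Average.
Variables (R : realType) (V : choiceType) (e : rel V).
Implicit Types (G : set V) (x : V) (f g : V -> R).

Definition avg G x f : R :=
  (degree e G x)%:R^-1 * \sum_(y <- fset_set (neighbors e G x)) f y.

Definition walkable G x : Prop :=
  finite_set (neighbors e G x) /\ neighbors e G x !=set0.

Lemma degree_gt0 G x : walkable G x -> (0 < degree e G x)%N.
Proof.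
case=> fin [y Gy]; rewrite /degree cardfs_gt0.
by apply/fset0Pn; exists y; rewrite in_fset_set// inE.
Qed.

Lemma avg_cst G x (a : R) : walkable G x -> avg G x (fun=> a) = a.
Proof.
move=> /degree_gt0 d0; rewrite /avg big_const_seq count_predT.
rewrite iter_addr addr0 -[a *+ _]mulr_natl mulrA mulVf ?mul1r//.
by rewrite pnatr_eq0 -lt0n.
Qed.

Lemma ler_avg G x f g : finite_set (neighbors e G x) ->
  (forall y, neighbors e G x y -> f y <= g y) -> avg G x f <= avg G x g.
Proof.
move=> fin fg; rewrite /avg ler_wpM2l ?invr_ge0 ?ler0n//.
rewrite big_seq [leRHS]big_seq; apply: ler_sum => y.
by rewrite in_fset_set// inE => /fg.
Qed.

Lemma eq_avg G x f g : finite_set (neighbors e G x) ->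
  (forall y, neighbors e G x y -> f y = g y) -> avg G x f = avg G x g.
Proof.
by move=> fin fg; apply/eqP; rewrite eq_le !ler_avg// => y /fg ->.
Qed.

Lemma avgD G x f g : avg G x (fun y => f y + g y) = avg G x f + avg G x g.
Proof. by rewrite /avg big_split mulrDr. Qed.

Lemma avgZ G x (a : R) f : avg G x (fun y => a * f y) = a * avg G x f.
Proof. by rewrite /avg -mulr_sumr mulrCA. Qed.

Lemma avgN G x f : avg G x (fun y => - f y) = - avg G x f.
Proof. by rewrite /avg sumrN mulrN. Qed.

Lemma avg_ge_nbr G x f (D : nat) y : walkable G x -> (degree e G x <= D)%N ->
  neighbors e G x y -> (forall y', neighbors e G x y' -> 0 <= f y') ->
  f y / D%:R <= avg G x f.
Proof.
move=> Gx dD xy f0; have [fin _] := Gx.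
have d0 := degree_gt0 Gx.
rewrite /avg mulrC; apply: (@le_trans _ _ ((degree e G x)%:R^-1 * f y)).
  rewrite ler_wpM2r ?f0// lef_pV2 ?posrE ?ltr0n ?ler_nat//.
  exact: leq_trans d0 dD.
rewrite ler_wpM2l ?invr_ge0 ?ler0n//.
rewrite (big_fsetD1 y)/=; last by rewrite in_fset_set// inE.
rewrite lerDl big_seq sumr_ge0// => y'; rewrite in_fsetD1 => /andP[_].
by rewrite in_fset_set// inE => /f0.
Qed.

End Average.

Section Walk.
Variables (R : realType) (V : choiceType) (e : rel V).
Variables (G : (nat -> V) -> nat -> set V) (x0 : V).
Implicit Types (z : nat -> V) (t n j : nat).

(** With [G_walkable], these are the histories of positive probability. Lying in the current domain,
    hence having a neighbor there, can be asserted only along them. *)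
Definition valid z t : Prop :=
  z 0%N = x0 /\ forall s, (s < t)%N -> neighbors e (G z s) (z s) (z s.+1).

(* The expectation of [F] over [j] more steps of the walk after the history
   [z 0, ..., z t]. *)
Fixpoint expect j t z (F : (nat -> V) -> R) : R :=
  if j is j'.+1 then
    avg e (G z t) (z t) (fun y => expect j' t.+1 (update z t.+1 y) F)
  else F z.

Hypothesis G_adapted : adapted G.
Hypothesis G_walkable : forall z t, valid z t -> walkable e (G z t) (z t).

Lemma valid_agree z z' t : agree t z z' -> valid z t -> valid z' t.
Proof.
move=> zz' [z0 zt]; split; first by rewrite -zz'.
move=> s st; have := zt s st.
by rewrite (G_adapted (agreeW (ltnW st) zz')) (zz' s) ?(zz' s.+1)// ltnW.
Qed.

Lemma valid_update z t y : valid z t -> neighbors e (G z t) (z t) y ->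
  valid (update z t.+1 y) t.+1.
Proof.
move=> zt zy; have ag := agree_update z t y.
have [z0 zs] := valid_agree ag zt; split => // s.
rewrite ltnS leq_eqVlt => /predU1P[->|/zs//].
by rewrite -(G_adapted ag) update_same update_lt.
Qed.

Lemma expect_le j t z F F' : valid z t ->
  (forall z', agree t z z' -> valid z' (t + j) -> F z' <= F' z') ->
  expect j t z F <= expect j t z F'.
Proof.
elim: j t z => [|j IH] t z zt FF' /=.
  by apply: FF' => //; rewrite addn0.
have [fin _] := G_walkable zt; apply: ler_avg => // y zy.
apply: IH; first exact: valid_update.
move=> z' zz' z'j; apply: FF'; last by rewrite addnS -addSn.
move=> s st; rewrite -zz' ?update_lt//; exact: leqW.
Qed.

Lemma expect_cat i j t z F :
  expect (i + j) t z F = expect i t z (fun z' => expect j (t + i) z' F).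
Proof.
elim: i t z => [|i IH] t z; first by rewrite addn0.
by rewrite addSn /=; congr avg; apply/funext => y; rewrite IH addSnnS.
Qed.

Lemma expect_supermartingale n (M : (nat -> V) -> nat -> R) :
  (forall t z, (n <= t)%N -> valid z t ->
     avg e (G z t) (z t) (fun y => M (update z t.+1 y) t.+1) <= M z t) ->
  forall j z, valid z n -> expect j n z (M ^~ (n + j)%N) <= M z n.
Proof.
move=> super j z zn.
suff main t : (n <= t)%N -> forall y, valid y t ->
    expect j t y (M ^~ (t + j)%N) <= M y t by exact: main.
elim: j t => [|j IH] t nt y yt; first by rewrite addn0.
rewrite /=; apply: le_trans (super _ _ nt yt).
have [fin _] := G_walkable yt; apply: ler_avg => // x yx.
by rewrite addnS -addSn; apply: IH; [exact: leqW|exact: valid_update].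
Qed.

Lemma expectZ j t z (a : R) F :
  expect j t z (fun z' => a * F z') = a * expect j t z F.
Proof.
elim: j t z => //= j IH t z; rewrite -avgZ.
by congr avg; apply/funext => y; rewrite IH.
Qed.

Section Law.
Variables (d : measure_display) (T : measurableType d) (P : probability T R).
Variable Z : nat -> T -> V.
Hypothesis Z_walk : walk_on_domains e G x0 P Z.
Hypothesis V_countable : countable [set: V].

Definition depends_upto (n : nat) (A : set (nat -> V)) : Prop :=
  forall z z', agree n z z' -> A z -> A z'.

(** The event is a countable union over the value of the last coordinate, and fixing that value
    leaves an event about one coordinate fewer. The strict bound [s < m] lets the induction start
    from events that depend on nothing. *)
Lemma measurable_upto n (A : set (nat -> V)) : depends_upto n A ->
  measurable [set w | A (Z ^~ w)].
Proof.
have [mZ _ _] := Z_walk.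
suff main m (B : set (nat -> V)) :
    (forall z z', (forall s, (s < m)%N -> z s = z' s) -> B z -> B z') ->
    measurable [set w | B (Z ^~ w)].
  by move=> dA; apply: (main n.+1) => z z' zz'; apply: dA => s sn; exact: zz'.
elim: m B => [|m IH] B dB.
  have [[z Bz]|nB] := pselect (exists z, B z).
    rewrite (_ : [set w | _] = setT)//; apply/seteqP; split => // w _.
    by apply: dB Bz.
  rewrite (_ : [set w | _] = set0)//; apply/seteqP; split => // w Bw.
  by apply: nB; exists (Z ^~ w).
have -> : [set w | B (Z ^~ w)] =
    \bigcup_y ([set w | Z m w = y] `&` [set w | B (update (Z ^~ w) m y)]).
  apply/seteqP; split => [w Bw|w [y _ [/= Zw]]].
    exists (Z m w) => //; split=> //=; apply: dB Bw => s sm.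
    by rewrite /update; case: eqP => // ->.
  by apply: dB => s sm; rewrite /update; case: eqP => // ->.
apply: countable_bigcupT_measurable => // y.
apply: measurableI; first exact: (mZ m [set y]).
apply: (IH [set z | B (update z m y)]) => z z' zz'; apply: dB => s sm.
rewrite /update; case: eqP => // /eqP sm'; apply: zz'.
by rewrite ltn_neqAle sm' -ltnS.
Qed.

Let cylinder z t := [set w | forall s, (s <= t)%N -> Z s w = z s].

Lemma measurable_cylinder z t : measurable (cylinder z t).
Proof.
apply: (@measurable_upto t [set z' | agree t z' z]) => z1 z2 z12 z1z s st.
by rewrite -z12 ?z1z.
Qed.

Lemma prob_cylinder_update z t y : valid z t -> neighbors e (G z t) (z t) y ->
  P (cylinder (update z t.+1 y) t.+1) =
  (P (cylinder z t) * ((degree e (G z t) (z t))%:R^-1)%:E)%E.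
Proof.
move=> zt zy; have [_ _ /(_ (update z t.+1 y) t)] := Z_walk.
have ag := agree_update z t y.
rewrite -(G_adapted ag) update_lt// update_same /unif_step mem_set//.
move=> ->; congr (P _ * _)%E; apply/seteqP; split => w wz s st.
  by rewrite wz// ag.
by rewrite wz// -ag.
Qed.

(** By induction on j: up to a null set, a cylinder is the disjoint union of its extensions by one
    neighbor, each of which carries the same share of its probability. *)
Lemma prob_cylinderI j t z (A : set (nat -> V)) :
  valid z t -> depends_upto (t + j) A ->
  P (cylinder z t `&` [set w | A (Z ^~ w)]) =
  (P (cylinder z t) * (expect j t z (fun z' => (z' \in A)%:R))%:E)%E.
Proof.
elim: j t z => [|j IH] t z zt dA /=.
  rewrite addn0 in dA; have [Az|nAz] := pselect (A z).
    rewrite mem_set// mule1 (_ : _ `&` _ = cylinder z t)//.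
    apply/seteqP; split => [w []//|w wz]; split=> //=.
    by apply: dA Az => s st; rewrite wz.
  rewrite memNset// mule0 (_ : _ `&` _ = set0) ?measure0//.
  apply/seteqP; split => // w [wz Aw]; apply: nAz.
  by apply: dA Aw => s st; rewrite wz.
have [fin _] := G_walkable zt; set D := neighbors e (G z t) (z t).
have dA' : depends_upto (t.+1 + j) A by rewrite addSnnS.
pose C y := cylinder (update z t.+1 y) t.+1.
have mA : measurable [set w | A (Z ^~ w)] by exact: measurable_upto dA.
have mC y : measurable (C y) by exact: measurable_cylinder.
have CE y w : C y w -> Z t.+1 w = y by move=> /(_ t.+1 (leqnn _)); rewrite update_same.
have triv : trivIset D C.
  by move=> y y' _ _ [w [/CE <- /CE]].
have Csub y : C y `<=` cylinder z t.
  by move=> w Cw s st; rewrite Cw ?update_lt// leqW.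
have sumC : P (\bigcup_(y in D) C y) = P (cylinder z t).
  rewrite measure_fin_bigcup// fsbig_finite// big_seq.
  rewrite (eq_bigr (fun=> (P (cylinder z t) *
      ((degree e (G z t) (z t))%:R^-1)%:E)%E)); last first.
    move=> y; rewrite in_fset_set// inE => zy.
    exact: prob_cylinder_update.
  rewrite -big_seq -ge0_sume_distrr//.
  rewrite sumEFin big_const_seq count_predT.
  rewrite iter_addr addr0 -[_^-1 *+ _]mulr_natl mulfV ?mule1//.
  by rewrite pnatr_eq0 -lt0n; apply: degree_gt0; exact: G_walkable.
have mU : measurable (\bigcup_(y in D) C y) by exact: fin_bigcup_measurable.
have finC : P (cylinder z t) \is a fin_num.
  by rewrite fin_num_measure//; exact: measurable_cylinder.
have UC : \bigcup_(y in D) C y `<=` cylinder z t by exact: bigcup_sub.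
(* A step to a non-neighbor is not excluded pointwise; the extensions just exhaust the probability
   of the cylinder. *)
have null : P (cylinder z t `\` \bigcup_(y in D) C y) = 0.
  have -> : P (cylinder z t `\` \bigcup_(y in D) C y) =
      (P (cylinder z t) - P (\bigcup_(y in D) C y))%E.
    rewrite measureD ?(setIidr UC)//; first exact: measurable_cylinder.
    by rewrite -ge0_fin_numE.
  by rewrite sumC subee.
transitivity (P (\bigcup_(y in D) (C y `&` [set w | A (Z ^~ w)]))).
  rewrite -setI_bigcupl; apply/eqP; rewrite eq_le; apply/andP; split; last first.
    apply: le_measure; rewrite ?inE; [exact: measurableI|..].
      by apply: measurableI => //; exact: measurable_cylinder.
    exact: setSI.
  apply: (le_prob_null _ _ _ null).
  - exact: measurableI.
  - by apply: measurableI => //; exact: measurable_cylinder.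
  - by apply: measurableD => //; exact: measurable_cylinder.
  move=> w [wz Aw]; have [?|?] := pselect ((\bigcup_(y in D) C y) w).
    by left.
  by right.
rewrite measure_fin_bigcup//; last 2 first.
- by move=> y y' Dy Dy' [w [[Cy _] [Cy' _]]]; apply: triv => //; exists w.
- by move=> y _; exact: measurableI.
rewrite fsbig_finite// /avg big_seq.
rewrite (eq_bigr (fun y => (P (cylinder z t) *
   ((degree e (G z t) (z t))%:R^-1 *
   expect j t.+1 (update z t.+1 y) (fun z' => (z' \in A)%:R))%:E)%E)).
  rewrite -big_seq mulr_sumr -sumEFin -[P (cylinder z t)]fineK//.
  by rewrite sumEFin -EFinM mulr_sumr -sumEFin; apply: eq_bigr => y _; rewrite -EFinM.
move=> y; rewrite in_fset_set// inE => zy.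
apply: (etrans (IH _ _ (valid_update zt zy) dA')).
by rewrite prob_cylinder_update// -muleA -EFinM.
Qed.

Lemma prob_upto n (A : set (nat -> V)) : depends_upto n A ->
  P [set w | A (Z ^~ w)] =
  (expect n 0 (fun=> x0) (fun z' => (z' \in A)%:R))%:E.
Proof.
move=> dA; have [mZ P0 _] := Z_walk.
have v0 : valid (fun=> x0) 0 by split.
have C1 : P (cylinder (fun=> x0) 0) = 1%E.
  rewrite -P0; congr (P _); apply/seteqP; split => w; first by apply.
  by move=> /= w0 s; rewrite leqn0 => /eqP ->.
have := prob_cylinderI v0 dA; rewrite C1 mul1e => <-.
have mC := measurable_cylinder (fun=> x0) 0.
have mA := measurable_upto dA.
have nC : P (~` cylinder (fun=> x0) 0) = 0 by rewrite probability_setC// C1 subee.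
apply/eqP; rewrite eq_le; apply/andP; split; last first.
  by apply: le_measure; rewrite ?inE//; exact: measurableI.
apply: (le_prob_null _ _ _ nC) => //.
- exact: measurableI.
- exact: measurableC.
- by move=> w Aw; have [?|?] := pselect (cylinder (fun=> x0) 0 w); [left|right].
Qed.

End Law.
End Walk.

(** * Negligible sets and the maximal inequality *)

Section SmallSets.
Variables (R : realType) (d : measure_display) (T : measurableType d).
Variable P : probability T R.

(** E need not be measurable: it lies in the intersection of measurable covers of probability at
    most 1/(n+1). *)
Lemma small_negligible (E : set T) :
  (forall eps : R, 0 < eps ->
    exists2 F, measurable F /\ (P F <= eps%:E)%E & E `<=` F) ->
  P.-negligible E.
Proof.
move=> small.
have /choice[F FP] (n : nat) : exists F,
    [/\ measurable F, (P F <= (n.+1%:R^-1 : R)%:E)%E & E `<=` F].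
  have [|F [mF PF EF]] := small n.+1%:R^-1; first by rewrite invr_gt0.
  by exists F.
have mF : measurable (\bigcap_n F n).
  by apply: bigcapT_measurable => n; have [] := FP n.
exists (\bigcap_n F n); split => //; last first.
  by move=> w Ew n _; have [_ _] := FP n; exact.
apply/eqP; rewrite eq_le measure_ge0 andbT; apply/lee_addgt0Pr => eps eps0.
rewrite add0e; have [n _ neps] := near_infty_natSinv_lt (PosNum eps0).
have [mFn PFn _] := FP n.
apply: (@le_trans _ _ (P (F n))).
  by apply: le_measure; rewrite ?inE// => w; apply.
by apply: le_trans PFn _; rewrite lee_fin ltW//; exact: (neps n (leqnn n)).
Qed.

Lemma le_prob_bigcup (F : nat -> set T) (a : R) :
  (forall n, measurable (F n)) -> {homo F : n m / (n <= m)%N >-> n `<=` m} ->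
  (forall n, P (F n) <= a%:E)%E -> (P (\bigcup_n F n) <= a%:E)%E.
Proof.
move=> mF ndF PF; have mU : measurable (\bigcup_n F n) by exact: bigcupT_measurable.
have ndF' : nondecreasing_seq F by move=> n m nm; apply/subsetPset; exact: ndF.
have cF := nondecreasing_cvg_mu (mu := P) mF mU ndF'.
have := cvg_lim (@ereal_hausdorff R) cF; move=> <-; apply: lime_le.
  by apply/cvg_ex; exists (P (\bigcup_n F n)).
by apply: nearW => n; exact: PF.
Qed.

End SmallSets.

Section MaximalInequality.
Variables (R : realType) (V : choiceType) (e : rel V).
Variables (G : (nat -> V) -> nat -> set V) (x0 : V).
Hypothesis G_adapted : adapted G.
Hypothesis G_walkable :
  forall z t, valid e G x0 z t -> walkable e (G z t) (z t).
Variables (d : measure_display) (T : measurableType d) (P : probability T R).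
Variable Z : nat -> T -> V.
Hypothesis Z_walk : walk_on_domains e G x0 P Z.
Hypothesis V_countable : countable [set: V].
Implicit Types (z : nat -> V) (t n : nat).

Definition supermartingale n (M : (nat -> V) -> nat -> R) : Prop :=
  [/\ adapted M, forall z t, (n <= t)%N -> valid e G x0 z t -> 0 <= M z t &
      forall z t, (n <= t)%N -> valid e G x0 z t ->
       avg e (G z t) (z t) (fun y => M (update z t.+1 y) t.+1) <= M z t].

Lemma measurable_adapted M (L : R) t : adapted M ->
  measurable [set w | L <= M (Z ^~ w) t].
Proof.
move=> aM; apply: (measurable_upto Z_walk V_countable (n := t)
  (A := [set z | L <= M z t])) => z z' zz' /=.
by rewrite (aM _ _ _ zz').
Qed.

(** Only paths that stay above L from some time on are covered. They form an increasing union of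
    events, each contained in the event that M is at least L at the single time n + m, so Markov's
    inequality there suffices. Processes frozen at their target turn reaching L into staying
    there. *)
Lemma maximal_inequality n M (L : R) : 0 < L -> supermartingale n M ->
  exists2 F : set T, measurable F /\
    (P F <= (expect e G n 0 (fun=> x0) (M ^~ n) / L)%:E)%E &
    [set w | exists t0, forall t, (t0 <= t)%N -> L <= M (Z ^~ w) t] `<=` F.
Proof.
move=> L0 [aM M0 Msup].
pose F m := \bigcap_(t in [set t | (n + m <= t)%N]) [set w | L <= M (Z ^~ w) t].
have mF m : measurable (F m).
  apply: bigcap_measurable => [|t _]; last exact: measurable_adapted.
  by exists (n + m)%N => /=.
exists (\bigcup_m F m); first split.
- exact: bigcupT_measurable.
- apply: le_prob_bigcup => // [m m' mm' w Fw t /= nt|m].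
    by apply: Fw => /=; apply: leq_trans nt; rewrite leq_add2l.
  have dA : depends_upto (n + m) [set z | L <= M z (n + m)%N].
    by move=> z z' zz' /=; rewrite (aM _ _ _ zz').
  apply: (@le_trans _ _ (P [set w | L <= M (Z ^~ w) (n + m)%N])).
    apply: le_measure; rewrite ?inE//; first exact: measurable_adapted.
    by move=> w; apply => /=.
  rewrite (prob_upto G_adapted G_walkable Z_walk V_countable dA) lee_fin.
  have v0 : valid e G x0 (fun=> x0) 0 by split.
  rewrite ler_pdivlMr// mulrC -expectZ.
  apply: le_trans (_ : expect e G (n + m) 0 (fun=> x0) (M ^~ (n + m)%N) <= _).
    apply: (expect_le G_adapted G_walkable) => // z _ vz.
    have := M0 _ _ (leq_addr m n) vz.
    have [Lz|nLz] := boolP (L <= M z (n + m)%N).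
      by rewrite mem_set// mulr1.
    by rewrite memNset ?mulr0//; exact/negP.
  rewrite expect_cat; apply: (expect_le G_adapted G_walkable) => // z _ vz.
  rewrite add0n.
  apply: (expect_supermartingale (n := n) G_adapted G_walkable) => // *.
  exact: Msup.
- move=> w [t0 t0P]; exists t0 => // t /= t0t; apply: t0P.
  exact: leq_trans (leq_addl _ _) t0t.
Qed.

Lemma supermartingale_not_cvg_pinfty n M (E : set (nat -> V)) :
  supermartingale n M ->
  (forall z L, E z -> exists t0, forall t, (t0 <= t)%N -> L <= M z t) ->
  P.-negligible [set w | E (Z ^~ w)].
Proof.
move=> super MoO; apply: small_negligible => eps eps0.
set K := expect e G n 0 (fun=> x0) (M ^~ n).
(* At this level the bound K / L is at most eps; adding 1 keeps the level positive when K = 0. *)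
have L0 : 0 < (`|K| + 1) / eps by rewrite divr_gt0// ltr_pwDr.
have [F [mF PF] FE] := maximal_inequality L0 super.
exists F; last by move=> w /MoO Ew; apply: FE; exact: Ew.
split=> //; apply: le_trans PF _; rewrite lee_fin ler_pdivrMr// -/K.
rewrite mulrCA mulfV ?gt_eqF// mulr1.
by apply: le_trans (ler_norm _) _; rewrite lerDl.
Qed.

End MaximalInequality.

(** * Stages of the EGS walk *)

Section Seen.
Variable V : Type.
Implicit Types (Q : (nat -> V) -> nat -> bool) (z : nat -> V).

(** This replaces a stopping time: whether the process is already frozen is read off the history up
    to t. *)
Fixpoint seen Q z t : bool :=
  if t is t'.+1 then seen Q z t' || Q z t else Q z 0%N.

Lemma seenP Q z t : reflect (exists2 s, (s <= t)%N & Q z s) (seen Q z t).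
Proof.
elim: t => [|t IH] /=.
  apply: (iffP idP) => [Q0|[s]]; first by exists 0%N.
  by rewrite leqn0 => /eqP ->.
apply: (iffP orP) => [[/IH[s st Qs]|Qt]|[s]].
- by exists s => //; exact: leqW.
- by exists t.+1.
- rewrite leq_eqVlt => /predU1P[->|st Qs]; [by right|left].
  by apply/IH; exists s.
Qed.

Lemma adapted_seen Q : adapted Q -> adapted (seen Q).
Proof.
move=> aQ; elim=> [|n IH] z z' zz' /=; first exact: aQ.
by rewrite (IH _ _ (agreeW (leqnSn n) zz')) (aQ _ _ _ zz').
Qed.

Lemma seen_update Q z t y : adapted Q ->
  seen Q (update z t.+1 y) t.+1 = seen Q z t || Q (update z t.+1 y) t.+1.
Proof. by move=> aQ /=; rewrite -(adapted_seen aQ (agree_update z t y)). Qed.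

End Seen.

Lemma nat_infP (A : set nat) v : nat_inf A = Some v ->
  A v /\ forall m, A m -> (v <= m)%N.
Proof.
rewrite /nat_inf; case: pselect => // exA [<-]; case: ex_minnP => m Am mmin.
by split=> [|k Ak]; [exact: set_mem|apply: mmin; exact: mem_set].
Qed.

Lemma nat_inf_min (A : set nat) v : A v -> (forall m, A m -> (v <= m)%N) ->
  nat_inf A = Some v.
Proof.
move=> Av vmin; rewrite /nat_inf; case: pselect => [exA|nA]; last first.
  by exfalso; apply: nA; exists v; exact: mem_set.
congr Some; case: ex_minnP => m Am mmin; apply/eqP.
by rewrite eqn_leq vmin ?mmin//; [exact: mem_set|exact: set_mem].
Qed.

Lemma bounded_nondecreasing_stationary (f : nat -> nat) n b :
  (forall t, (n <= t)%N -> (f t <= f t.+1)%N) ->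
  (forall t, (n <= t)%N -> (f t <= b)%N) ->
  exists2 m, (n <= m)%N & forall t, (m <= t)%N -> f t = f m.
Proof.
move=> nd fb; pose A v := `[< exists2 t, (n <= t)%N & f t = v >].
have exA : exists v, A v by exists (f n); apply/asboolP; exists n.
have Ab v : A v -> (v <= b)%N by move=> /asboolP[t nt <-]; exact: fb.
have [v /asboolP[m nm fm] vmax] := ex_maxnP exA Ab.
exists m => // t mt; apply/eqP; rewrite eqn_leq fm vmax /=; last first.
  by apply/asboolP; exists t => //; exact: leq_trans mt.
rewrite -fm -(subnKC mt); elim: (t - m)%N => [|i IH]; first by rewrite addn0.
by rewrite addnS; apply: leq_trans IH (nd _ _); exact: leq_trans (leq_addr _ _).
Qed.

Section State.
Variables (V : choiceType) (e : rel V) (B : nat -> set V) (N : nat -> nat).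
Implicit Types (z : nat -> V) (t k j : nat).

Local Notation bd k := (graph_boundary e (B k)).

(* The stage [k] with [tau_k <= t < tau_{k+1}] and the number of visits to the
   boundary of [B k] during [tau_k, ..., t - 1]. *)
Fixpoint egs_state z t : nat * nat :=
  if t is t'.+1 then
    let: (k, j) := egs_state z t' in
    if z t' \in bd k then
      if j.+1 == N k then (k.+1, 0%N) else (k, j.+1)
    else (k, j)
  else (1%N, 0%N).

(** The state at time t does not involve the position at time t. Hence averaging over the next
    position leaves the next state fixed, on which all the one-step inequalities rely. *)
Lemma egs_state_predictable z z' t :
  (forall s, (s < t)%N -> z s = z' s) -> egs_state z t = egs_state z' t.
Proof.
elim: t => //= t IH zz'; rewrite IH => [|s st]; first by rewrite zz'.
by apply: zz'; exact: leqW.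
Qed.

Lemma adapted_egs_state : adapted egs_state.
Proof. by move=> n z z' zz'; apply: egs_state_predictable => s /ltnW /zz'. Qed.

Lemma egs_state_update z t y : egs_state (update z t.+1 y) t.+1 = egs_state z t.+1.
Proof. by apply: egs_state_predictable => s st; rewrite update_lt. Qed.

Hypothesis N_ge1 : forall k, (1 <= k)%N -> (1 <= N k)%N.

Lemma egs_stage_ge1 z t : (1 <= (egs_state z t).1)%N.
Proof.
elim: t => //= t; case: (egs_state z t) => k j /= k1.
by case: ifP => // _; case: ifP.
Qed.

Lemma egs_visits_lt z t : ((egs_state z t).2 < N (egs_state z t).1)%N.
Proof.
elim: t => [|t] /=; first exact: N_ge1.
have := egs_stage_ge1 z t; case: (egs_state z t) => k j /= k1 jN.
case: ifP => // _; case: ifP => [_|/eqP jNk /=]; first exact: N_ge1.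
by rewrite ltn_neqAle jN andbT; exact/eqP.
Qed.

Lemma egs_stage_leS z t : ((egs_state z t).1 <= (egs_state z t.+1).1)%N.
Proof.
by rewrite /=; case: (egs_state z t) => k j; case: ifP => // _; case: ifP.
Qed.

Lemma egs_stage_le z s t : (s <= t)%N ->
  ((egs_state z s).1 <= (egs_state z t).1)%N.
Proof.
move=> /subnKC <-; elim: (t - s)%N => [|i IH]; first by rewrite addn0.
by rewrite addnS; apply: leq_trans IH (egs_stage_leS _ _).
Qed.

Lemma egs_tauS z k : (1 <= k)%N ->
  egs_tau e B N z k.+1 =
    if egs_tau e B N z k is Some u then
      nat_inf [set s | (u < s)%N /\ (\sum_(u <= t < s) (z t \in bd k))%N = N k]
    else None.
Proof. by case: k. Qed.

Lemma egs_tau_le z i k v : (1 <= i <= k)%N -> egs_tau e B N z k = Some v ->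
  exists2 u, egs_tau e B N z i = Some u & (u <= v)%N.
Proof.
elim: k v => [|k IH] v /andP[i1 ik]; first by rewrite leqNgt i1 in ik.
move: ik; rewrite leq_eqVlt ltnS => /predU1P[-> tv|ik]; first by exists v.
rewrite egs_tauS; last exact: leq_trans ik.
case E: (egs_tau _ _ _ _ _) => [w|//] /nat_infP[[wv _] _].
have [|u tu uw] := IH w _ E; first by rewrite i1.
by exists u => //; apply: leq_trans uw (ltnW wv).
Qed.

(** This links the recursion to the definition of the times tau_k. Both count the visits strictly
    before t. *)
Lemma egs_state_tau z t (k := (egs_state z t).1) :
  exists u, [/\ egs_tau e B N z k = Some u, (u <= t)%N &
    (\sum_(u <= s < t) (z s \in bd k))%N = (egs_state z t).2].
Proof.
rewrite /k {k}; elim: t => [|t]; first by exists 0%N; rewrite big_geq.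
have := egs_stage_ge1 z t; have := egs_visits_lt z t.
rewrite /=; case: (egs_state z t) => k j /= jN k1 [u [tu ut sumj]].
have sumS : (\sum_(u <= s < t.+1) (z s \in bd k))%N = (j + (z t \in bd k))%N.
  by rewrite big_nat_recr//= sumj.
case: (z t \in bd k) sumS => sumS; last first.
  by exists u; rewrite tu sumS addn0 leqW.
rewrite addn1 in sumS; case: eqP => [jNk|_]; last first.
  by exists u; rewrite tu sumS leqW.
(* The counts up to any m <= t are at most j < N k, so the count first reaches N k at t.+1: the new
   stage starts right after the last visit. *)
exists t.+1; rewrite big_geq//; split => //; rewrite egs_tauS// tu.
apply: nat_inf_min => [|m [um sumN]]; first by rewrite /= sumS jNk.
rewrite leqNgt; apply/negP; rewrite ltnS => mt.
have : (N k <= j)%N; last by rewrite leqNgt jN.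
by rewrite -sumN -sumj [leqRHS](big_cat_nat (ltnW um) mt)/= leq_addr.
Qed.

Lemma egs_stage_state z t k :
  egs_stage e B N z t k <-> k = (egs_state z t).1.
Proof.
set k0 := (egs_state z t).1.
have [u [tu ut sumj]] := egs_state_tau z t; rewrite -/k0 in tu sumj.
have k01 : (1 <= k0)%N := egs_stage_ge1 z t.
have stop v : egs_tau e B N z k0.+1 = Some v -> (t < v)%N.
  rewrite egs_tauS// tu => /nat_infP[[uv sumN] _].
  rewrite ltnNge; apply/negP => vt.
  have := egs_visits_lt z t; rewrite ltnNge -/k0 -sumN -sumj.
  by rewrite [leqRHS](big_cat_nat (ltnW uv) vt)/= leq_addr.
split=> [[k1 [v tv vt] kstop]|->]; last first.
  by split => //; exists u.
apply/eqP; rewrite eqn_leq; apply/andP; split; rewrite leqNgt; apply/negP => kk.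
  have [|w tw wv] := @egs_tau_le z k0.+1 k v _ tv; first exact: kk.
  by have := leq_trans (stop _ tw) (leq_trans wv vt); rewrite ltnn.
have [|w tw wu] := @egs_tau_le z k.+1 k0 u _ tu; first exact: kk.
by have := leq_trans (kstop _ tw) (leq_trans wu ut); rewrite ltnn.
Qed.

Lemma egs_domainE z t : egs_domain e B N z t = B (egs_state z t).1.
Proof.
apply/seteqP; split => [x [k /egs_stage_state -> //]|x Bx].
by exists (egs_state z t).1 => //; apply/egs_stage_state.
Qed.

Lemma adapted_egs_domain : adapted (egs_domain e B N).
Proof.
by move=> n z z' zz'; rewrite !egs_domainE (adapted_egs_state zz').
Qed.

End State.

(** * Supermartingale criteria for recurrence and transience *)

Section Criteria.
Variables (R : realType) (V : choiceType) (e : rel V) (o : V).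
Variables (B : nat -> set V) (N : nat -> nat).
Hypothesis V_countable : countable [set: V].
Hypothesis N_ge1 : forall k, (1 <= k)%N -> (1 <= N k)%N.
Hypothesis B_o : B 1%N o.
Hypothesis B_le : forall k, (1 <= k)%N -> B k `<=` B k.+1.
Hypothesis B_walkable :
  forall k x, (1 <= k)%N -> B k x -> walkable e (B k) x.
Hypothesis B_exit : forall k, (1 <= k)%N -> exists psi : V -> R, exists2 eta : R,
  0 < eta & (forall x, psi x <= 1) /\
  forall x, B k x -> ~ graph_boundary e (B k) x ->
    psi x + eta <= avg e (B k) x psi.
Variables (d : measure_display) (T : measurableType d) (P : probability T R).
Variable Z : nat -> T -> V.
Hypothesis Z_egs : EGS e B N o P Z.
Implicit Types (z : nat -> V) (t k j : nat).

Local Notation bd k := (graph_boundary e (B k)).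
Local Notation state := (egs_state e B N).
Local Notation domain := (egs_domain e B N).

Lemma egs_valid_in z t : valid e domain o z t -> B (state z t).1 (z t).
Proof.
case: t => [[-> _]//|t [_ /(_ t (ltnSn t))]].
rewrite egs_domainE// => -[Bz _]; have k1 := egs_stage_ge1 e B N z t.
move: k1 Bz => /=; case: (state z t) => k j /= k1 Bz.
by case: ifP => // _; case: ifP => // _; exact: B_le.
Qed.

Lemma egs_walkable z t : valid e domain o z t -> walkable e (domain z t) (z t).
Proof.
move=> /egs_valid_in Bz; rewrite egs_domainE//; apply: B_walkable => //.
exact: egs_stage_ge1.
Qed.

(** As long as the state does not change, the walk avoids the boundary and psi gains eta per step on
    average, although psi <= 1. So 1 - psi + eta (t - n), set to 0 once the state has differed from
    (k, j), is a nonnegative supermartingale that tends to infinity on this event. *)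
Lemma egs_stage_stationary_negligible n k j :
  P.-negligible [set w | forall t, (n <= t)%N -> state (Z ^~ w) t = (k, j)].
Proof.
have [k1|k1] := boolP (1 <= k)%N; last first.
  rewrite (_ : [set w | _] = set0); first exact: negligible_set0.
  apply/seteqP; split => // w /(_ n (leqnn n)) stk.
  by have := egs_stage_ge1 e B N (Z ^~ w) n; rewrite stk (negbTE k1).
have [psi [eta eta0 [psi1 psi_sub]]] := B_exit k1.
pose Q z s := (n <= s)%N && (state z s != (k, j)).
have aQ : adapted Q by move=> m z z' zz'; rewrite /Q (adapted_egs_state e B N zz').
pose M z t : R := if seen Q z t then 0 else 1 - psi (z t) + eta * (t - n)%:R.
have M0 z t : 0 <= M z t.
  by rewrite /M; case: ifP => // _; rewrite addr_ge0 ?subr_ge0// mulr_ge0// ltW.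
apply: (supermartingale_not_cvg_pinfty (n := n) (M := M)
  (E := [set z | forall t, (n <= t)%N -> state z t = (k, j)])
  (adapted_egs_domain e B N_ge1) egs_walkable Z_egs V_countable).
- split => // [m z z' zz'|z t nt zt].
    by rewrite /M (adapted_seen aQ zz') (zz' m).
  have w := egs_walkable zt; have [fin _] := w.
  have [seent|nseent] := boolP (seen Q z t).
    rewrite (_ : M z t = 0); last by rewrite /M seent.
    rewrite -[leRHS](avg_cst 0 w); apply: ler_avg => // y _.
    by rewrite /M seen_update// seent.
  have stt : state z t = (k, j).
    apply/eqP; apply: contraNT nseent => stt.
    by apply/seenP; exists t => //; rewrite /Q nt.
  (* A visit to the boundary changes the state, so M vanishes at the next time. *)
  have [bz|nbz] := pselect (bd k (z t)).
    apply: (@le_trans _ _ 0) => //.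
    rewrite -[leRHS](avg_cst 0 w); apply: ler_avg => // y _.
    rewrite /M seen_update// /Q egs_state_update leqW//= stt mem_set//=.
    rewrite (_ : (_ == _) = false) ?orbT//; apply/eqP.
    by case: ifP => _ [] => [/esym/n_Sn//|/esym/n_Sn].
  have MS y : M (update z t.+1 y) t.+1 =
      (1 + eta * (t.+1 - n)%:R) + - psi y.
    rewrite /M seen_update// (negbTE nseent) /Q egs_state_update leqW//=.
    by rewrite stt memNset// eqxx /= update_same addrAC.
  under [X in avg _ _ _ X]eq_fun do rewrite MS.
  rewrite avgD avg_cst// avgN /M (negbTE nseent) egs_domainE// stt /=.
  have := psi_sub _ _ nbz; have := egs_valid_in zt; rewrite stt /= => Bz.
  move=> /(_ Bz); rewrite subSn// -natr1; lra.
- move=> z L Ez; pose m := Num.trunc (`|L| / eta).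
  exists (n + m.+1)%N => t mt.
  have nt : (n <= t)%N by exact: leq_trans (leq_addr _ _) mt.
  rewrite /M ifF; last first.
    by apply/negP => /seenP[s _ /andP[ns]]; rewrite Ez// eqxx.
  rewrite -[leLHS]add0r lerD ?subr_ge0//.
  apply: le_trans (ler_norm _) _; rewrite mulrC -ler_pdivrMr//.
  apply: ltW; apply: lt_le_trans (truncnS_gt _) _.
  by rewrite ler_nat leq_subRL.
Qed.

(** A bounded stage is eventually constant; then the number of visits is nondecreasing and below N
    k, hence eventually constant as well. This leaves countably many triples (n, k, j). *)
Lemma egs_stage_bounded_negligible :
  P.-negligible [set w | exists k, forall t, ((state (Z ^~ w) t).1 <= k)%N].
Proof.
have := negligible_bigcup (fun n => negligible_bigcup (fun k =>
  negligible_bigcup (fun j => egs_stage_stationary_negligible n k j))).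
apply: negligibleS => w [b wb].
pose st := state (Z ^~ w).
have [m _ mP] := @bounded_nondecreasing_stationary (fun t => (st t).1) 0 b
  (fun t _ => egs_stage_leS e B N (Z ^~ w) t) (fun t _ => wb t).
have [t mt|t mt|n mn nP] := @bounded_nondecreasing_stationary
    (fun t => (st t).2) m (N (st m).1).
- have := mP t.+1 (leqW mt); have := mP t mt; rewrite /st /=.
  case: (state _ t) => k j /= ->; case: ifP => // _.
  by case: ifP => // _ /= /esym/n_Sn.
- by rewrite -(mP t mt); apply: ltnW; exact: egs_visits_lt.
exists n => //; exists (st m).1 => //; exists (st n).2 => // t nt /=.
by rewrite [LHS]surjective_pairing -/(st t) (mP t) ?(nP t)// (leq_trans mn).
Qed.

(** Only visits to o in stages k >= K count: the process has the value eps before stage K and is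
    frozen at 1 after the first such visit. A recurrent path with unbounded stages makes such a
    visit, so its probability is at most eps. *)
Lemma as_transient_criterion (k0 : nat) (f : nat -> V -> R) (s r : nat -> R) :
  (1 <= k0)%N ->
  (forall k x, (k0 <= k)%N -> 0 <= f k x) ->
  (forall k, (k0 <= k)%N -> 1 <= f k o) ->
  (forall k, (k0 <= k)%N -> 0 <= s k) ->
  (forall k, (k0 <= k)%N -> 0 <= r k) ->
  (forall k, (k0 <= k)%N -> (N k)%:R * s k + r k.+1 <= r k) ->
  (forall k x, (k0 <= k)%N -> B k x -> ~ bd k x -> x <> o ->
    avg e (B k) x (f k) <= f k x) ->
  (forall k x y, (k0 <= k)%N -> bd k x -> neighbors e (B k) x y ->
    f k y <= f k x + s k /\ f k.+1 y <= f k x + s k) ->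
  (forall eps, 0 < eps -> exists2 k, (k0 <= k)%N &
    forall x, bd k x -> f k x + r k <= eps) ->
  as_transient o P Z.
Proof.
move=> k01 f0 fo s0 r0 rS f_super f_bd f_small.
suff null : P.-negligible [set w | recurrent_path o (Z ^~ w) /\
    ~ exists k, forall t, ((state (Z ^~ w) t).1 <= k)%N].
  have := negligibleU null egs_stage_bounded_negligible.
  apply: negligibleS => w /=; rewrite /transient_path => /contrapT rec.
  have [bd|nbd] := pselect (exists k, forall t, ((state (Z ^~ w) t).1 <= k)%N).
    by right.
  by left.
apply: small_negligible => eps eps0.
(* Stage K is entered by a step from the boundary of the previous domain, of index K', which is
   where f + r <= eps is required. *)
have [K' k0K' small] := f_small _ eps0; set K := K'.+1.
have k0K : (k0 <= K)%N by exact: leqW.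
pose Q z t := (K <= (state z t).1)%N && (z t == o).
have aQ : adapted Q.
  by move=> m z z' zz'; rewrite /Q (adapted_egs_state e B N zz') (zz' m).
(* Each of the j visits already made in stage k has used up s k of the tail r k. *)
pose h x k j := f k x + r k - j%:R * s k.
pose M z t : R := if seen Q z t then 1
  else if (K <= (state z t).1)%N then h (z t) (state z t).1 (state z t).2 else eps.
have rem0 k j : (k0 <= k)%N -> (j <= N k)%N -> 0 <= r k - j%:R * s k.
  move=> kk jN; rewrite subr_ge0; apply: le_trans (rS _ kk).
  apply: (@le_trans _ _ ((N k)%:R * s k)); last by rewrite lerDl r0// leqW.
  by rewrite ler_wpM2r ?s0// ler_nat.
have M0 z t : 0 <= M z t.
  rewrite /M; case: ifP => // _; case: ifP => [Kt|_]; last exact: ltW.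
  have kk := leq_trans k0K Kt.
  rewrite /h -addrA addr_ge0 ?f0 ?rem0//.
  by apply: ltnW; exact: (egs_visits_lt e B N_ge1).
have MS_le z t y : ~~ seen Q z t -> (K <= (state z t.+1).1)%N ->
    M (update z t.+1 y) t.+1 <= h y (state z t.+1).1 (state z t.+1).2.
  move=> nseen Kt; rewrite /M seen_update// (negbTE nseen) /Q.
  rewrite egs_state_update Kt update_same /=; case: eqP => // ->.
  have kk := leq_trans k0K Kt; rewrite /h -addrA ler_wpDr ?fo//.
  exact: rem0 kk (ltnW (egs_visits_lt e B N_ge1 z t.+1)).
have super : supermartingale e domain o 0 M.
  split => // [m z z' zz'|z t _ zt].
    by rewrite /M (adapted_seen aQ zz') (zz' m)// (adapted_egs_state e B N zz').
  have w := egs_walkable zt; have [fin _] := w.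
  have le_cst (c : R) : (forall y, neighbors e (domain z t) (z t) y ->
      M (update z t.+1 y) t.+1 <= c) ->
      avg e (domain z t) (z t) (fun y => M (update z t.+1 y) t.+1) <= c.
    by move=> Mc; rewrite -[leRHS](avg_cst c w); exact: ler_avg.
  have [seent|nseen] := boolP (seen Q z t).
    rewrite [leRHS]/M seent; apply: le_cst => y _.
    by rewrite /M seen_update// seent.
  rewrite [leRHS]/M (negbTE nseen).
  have := egs_valid_in zt; have := MS_le z t ^~ nseen; move: le_cst w fin.
  rewrite egs_domainE// => le_cst w fin.
  have := egs_visits_lt e B N_ge1 z t.
  case st: (state z t) => [k j] /= jN MSh Bz.
  case: (leqP K k) => [Kk|kK].
    have kk := leq_trans k0K Kk.
    have zo : z t <> o.
      move/eqP => zo; move/negP: nseen; apply; apply/seenP; exists t => //.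
      by rewrite /Q st zo Kk.
    have [bz|nbz] := pselect (bd k (z t)).
      rewrite st /= in le_cst; apply: le_cst => y zy.
      have [fy fy'] := f_bd _ _ _ kk bz zy.
      have := MSh y; rewrite st mem_set//; case: eqP => [jNk|_] /=; rewrite /h.
        move=> /(_ (leqW Kk)) /le_trans; apply; rewrite mul0r subr0.
        have := rS _ kk; rewrite -jNk -natr1; lra.
      by move=> /(_ Kk) /le_trans; apply; rewrite -natr1; lra.
    move: MSh; rewrite st memNset//= => MSh; rewrite st /= in fin w.
    apply: (@le_trans _ _ (avg e (B k) (z t) (fun y => f k y + (r k - j%:R * s k)))).
      by apply: ler_avg => // y _; rewrite addrA; exact: MSh.
    by rewrite avgD avg_cst// /h -addrA lerD2r f_super.
  rewrite st /= in le_cst; apply: le_cst => y zy.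
  have [KS|SK] := leqP K (state z t.+1).1; last first.
    by rewrite /M seen_update// (negbTE nseen) /Q egs_state_update leqNgt SK.
  apply: le_trans (MSh y _) _; move: KS; rewrite /= st => // KS.
  move: KS; case: ifPn => [/set_mem bz|]; last by rewrite leqNgt kK.
  case: eqP => [jNk|_] /=; last by rewrite leqNgt kK.
  move=> Kk; have kE : k = K' by apply/eqP; rewrite eqn_leq; apply/andP.
  move: bz zy jN; rewrite kE /h mul0r subr0 => bz zy jN.
  have [_ fy'] := f_bd _ _ _ k0K' bz zy.
  have := small _ bz; have := rS _ k0K'.
  (* Since N K' >= 1, the tail r K' pays for the increment s K' and still leaves r K. *)
  have : s K' <= (N K')%:R * s K'.
    by rewrite ler_peMl ?s0// ler1n; apply: leq_ltn_trans jN.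
  by move: fy'; rewrite -/K; lra.
have [F [mF PF] FE] := maximal_inequality (adapted_egs_domain e B N_ge1)
  egs_walkable Z_egs V_countable ltr01 super.
exists F; first split => //.
  (* The initial stage 1 is below K, so M starts from eps. *)
  have K1 : (K <= 1)%N = false.
    by apply/negbTE; rewrite -ltnNge ltnS (leq_trans k01 k0K').
  by apply: le_trans PF _; rewrite lee_fin divr1 /= /M /= /Q /= K1.
move=> w [rec nbd]; apply: FE => /=.
have [t1 Kt1] : exists t, (K <= (state (Z ^~ w) t).1)%N.
  apply: contra_notP nbd => nK; exists K => t; apply: ltnW.
  by rewrite ltnNge; apply/negP => Kt; apply: nK; exists t.
have [t2 [t2o t12]] : exists t2, Z t2 w = o /\ (t1 <= t2)%N.
  apply: contra_notP rec => nt2; apply: (sub_finite_set (B := `I_t1)).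
    move=> t Zt /=; rewrite ltnNge; apply/negP => t1t; apply: nt2.
    by exists t.
  exact: finite_II.
exists t2 => t t2t; rewrite /M (_ : seen _ _ _ = true)//; apply/seenP.
exists t2 => //; rewrite /Q t2o eqxx andbT; apply: leq_trans Kt1 _.
exact: egs_stage_le.
Qed.

(** If recurrence fails, o is avoided from some time n on; n is fixed first, and the countable union
    over n is taken afterwards. As stages are unbounded, n may be chosen so late that the stage at
    time n is at least k0, where the estimates on g and p begin. *)
Lemma as_recurrent_criterion (k0 : nat) (g : nat -> V -> R) (C : R)
    (p : nat -> R) :
  (1 <= k0)%N ->
  (forall k x, (k0 <= k)%N -> g k x <= C) ->
  (forall k, (k0 <= k)%N -> 0 <= p k) ->
  (forall k x, (k0 <= k)%N -> B k x -> ~ bd k x -> x <> o ->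
    g k x <= avg e (B k) x (g k)) ->
  (forall k x, (k0 <= k)%N -> bd k x -> x <> o ->
    g k x + p k <= avg e (B k) x (g k) /\
    g k x + p k <= avg e (B k) x (g k.+1)) ->
  (forall L : R, exists k, L <= \sum_(k0 <= i < k) (N i)%:R * p i) ->
  as_recurrent o P Z.
Proof.
move=> k01 gC p0 g_sub g_bd pN.
pose acc k j : R := \sum_(k0 <= i < k) (N i)%:R * p i + j%:R * p k.
have sum_ge0 k k' : (k <= k')%N -> \sum_(k0 <= i < k) (N i)%:R * p i <=
    \sum_(k0 <= i < k') (N i)%:R * p i.
  move=> kk'; have [k0k|kk0] := leqP k0 k; last first.
    rewrite (big_geq (ltnW kk0)) big_nat sumr_ge0// => i /andP[ik _].
    by rewrite mulr_ge0 ?p0.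
  rewrite [leRHS](big_cat_nat k0k kk')/= lerDl big_nat sumr_ge0// => i.
  by case/andP=> ik _; rewrite mulr_ge0 ?p0// (leq_trans k0k).
suff null n : P.-negligible [set w | [/\ (k0 <= (state (Z ^~ w) n).1)%N,
    (forall t, (n <= t)%N -> Z t w <> o) &
    forall k, exists t, (k < (state (Z ^~ w) t).1)%N]].
  have := negligibleU (negligible_bigcup null) egs_stage_bounded_negligible.
  apply: negligibleS => w /= nrec.
  have [bd|nbd] := pselect (exists k, forall t, ((state (Z ^~ w) t).1 <= k)%N).
    by right.
  left; have big k : exists t, (k < (state (Z ^~ w) t).1)%N.
    apply: contra_notP nbd => nk; exists k => t.
    by rewrite leqNgt; apply/negP => kt; apply: nk; exists t.
  have [t1 t1P] : exists n, forall t, (n <= t)%N -> Z t w <> o.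
    apply: contrapT => nt; apply: nrec => fin; apply: nt.
    have /finite_fsetP[X XE] := fin; exists (\max_(i <- X) i).+1 => t Xt Zt.
    have /= tX : [set` X] t by rewrite -XE.
    by move: Xt; rewrite ltnNge (leq_bigmax_seq (F := id)).
  have [t2 t2P] := big k0.
  exists (maxn t1 t2) => //; split => //.
    by apply: leq_trans (ltnW t2P) _; apply: egs_stage_le; exact: leq_maxr.
  by move=> t t12; apply: t1P; apply: leq_trans t12; exact: leq_maxl.
pose Q z t := (n <= t)%N && (z t == o).
have aQ : adapted Q by move=> m z z' zz'; rewrite /Q (zz' m).
pose M z t : R := if seen Q z t || ((state z n).1 < k0)%N then 0
  else C - g (state z t).1 (z t) + acc (state z t).1 (state z t).2.
(* M refers to the stage at time n, so it is adapted only from time n on. *)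
pose M' z t := if (n <= t)%N then M z t else 0.
have acc0 k j : (k0 <= k)%N -> 0 <= acc k j.
  move=> kk; rewrite addr_ge0 ?mulr_ge0 ?p0//.
  by have := sum_ge0 _ _ kk; rewrite big_geq.
have M0 z t : (n <= t)%N -> 0 <= M z t.
  move=> nt; rewrite /M; case: ifPn => //; rewrite negb_or -leqNgt => /andP[_ kn].
  have kt : (k0 <= (state z t).1)%N by apply: leq_trans kn (egs_stage_le _ _ _ _ nt).
  by rewrite addr_ge0 ?acc0// subr_ge0 gC.
apply: (supermartingale_not_cvg_pinfty (n := n) (M := M')
  (E := [set z | [/\ (k0 <= (state z n).1)%N,
     (forall t, (n <= t)%N -> z t <> o) & forall k, exists t, (k < (state z t).1)%N]])
  (adapted_egs_domain e B N_ge1) egs_walkable Z_egs V_countable).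
- split => // [m z z' zz'|z t nt _|z t nt zt].
  + rewrite /M' /M; case: ifP => // nm.
    rewrite (adapted_seen aQ zz') (zz' m)// (adapted_egs_state e B N zz').
    by rewrite (adapted_egs_state e B N (agreeW nm zz')).
  + by rewrite /M' nt M0.
  have w := egs_walkable zt; have [fin _] := w.
  rewrite /M' nt.
  under [X in avg _ _ _ X]eq_fun do rewrite leqW//.
  have stn y : state (update z t.+1 y) n = state z n.
    by apply: egs_state_predictable => s sn; rewrite update_lt// (leq_trans sn)// leqW.
  have le0 : (forall y, neighbors e (domain z t) (z t) y ->
      M (update z t.+1 y) t.+1 = 0) ->
      avg e (domain z t) (z t) (fun y => M (update z t.+1 y) t.+1) <= M z t.
    move=> My; apply: (@le_trans _ _ 0); last exact: M0.
    by rewrite -[leRHS](avg_cst 0 w); apply: ler_avg => // y /My ->.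
  have [kn|kn] := ltnP (state z n).1 k0.
    by apply: le0 => y _; rewrite /M stn kn orbT.
  have [seent|nseen] := boolP (seen Q z t).
    by apply: le0 => y _; rewrite /M seen_update// seent.
  (* Freezing at 0 on the target only lowers M, because the unfrozen expression is nonnegative. So
     neighbors equal to o are covered by the same bound. *)
  have MS_le y : M (update z t.+1 y) t.+1 <=
      C + acc (state z t.+1).1 (state z t.+1).2 + - g (state z t.+1).1 y.
    have kt : (k0 <= (state z t.+1).1)%N.
      by apply: leq_trans kn _; apply: egs_stage_le; exact: leqW.
    rewrite /M; case: ifP => [_|_]; last by rewrite egs_state_update update_same addrAC.
    by rewrite addrAC addr_ge0 ?acc0// subr_ge0 gC.
  apply: le_trans (ler_avg fin (fun y _ => MS_le y)) _.
  rewrite avgD avgN avg_cst// /M ltnNge kn (negbTE nseen) /=.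
  have zo : z t <> o.
    move=> zo; move/negP: nseen; apply; apply/seenP; exists t => //.
    by rewrite /Q nt zo eqxx.
  have kt : (k0 <= (state z t).1)%N.
    by apply: leq_trans kn _; exact: egs_stage_le.
  have := egs_valid_in zt; rewrite egs_domainE//.
  case st: (state z t) kt => [k j] /= kk Bz.
  have [bz|nbz] := pselect (bd k (z t)); last first.
    by rewrite memNset//=; have := g_sub _ _ kk Bz nbz zo; lra.
  have [gk gk'] := g_bd _ _ kk bz zo.
  (* At the last visit of the stage, j.+1 = N k makes [acc k.+1 0] equal to [acc k j + p k], and g k
     gives way to g k.+1. *)
  rewrite mem_set//; case: eqP => [jNk|_] /=; rewrite /acc.
    by rewrite big_nat_recr//= -jNk -natr1; lra.
  by rewrite -natr1; lra.
- move=> z L [kn zo big]; have [K KL] := pN L; have [t0 Kt0] := big K.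
  exists (maxn n t0) => t; rewrite geq_max => /andP[nt t0t].
  rewrite /M' nt /M ifF; last first.
    rewrite ltnNge kn orbF; apply/negP => /seenP[s _ /andP[ns /eqP]].
    exact: zo.
  have kt : (k0 <= (state z t).1)%N by apply: leq_trans kn (egs_stage_le _ _ _ _ nt).
  rewrite -[leLHS]add0r lerD ?subr_ge0 ?gC//.
  apply: (le_trans KL); rewrite /acc -[leLHS]addr0 lerD ?mulr_ge0 ?p0//.
  by apply: sum_ge0; apply: leq_trans (ltnW Kt0) _; exact: egs_stage_le.
Qed.

End Criteria.

(** * Partial sums and tails of series *)

Section Series.
Variables (R : realType) (a : nat -> R).
Hypothesis a_ge0 : forall k, (1 <= k)%N -> 0 <= a k.

Let partial n := \sum_(1 <= k < n) a k.

Let cvg_partial :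
  (fun n => (partial n)%:E) @ \oo --> (\sum_(1 <= k <oo) (a k)%:E)%E.
Proof.
have : cvgn (fun n => \sum_(1 <= k < n) (a k)%:E)%E.
  by apply: is_cvg_nneseries => n n1 _; rewrite lee_fin a_ge0.
rewrite (_ : (fun n => (partial n)%:E) = fun n => (\sum_(1 <= k < n) (a k)%:E)%E).
  by [].
by apply/funext => n; rewrite sumEFin.
Qed.

Lemma series_pinfty_partial : (\sum_(1 <= k <oo) (a k)%:E = +oo)%E ->
  forall L : R, exists n, L <= \sum_(1 <= k < n) a k.
Proof.
move=> aoo L; apply: contrapT => nL.
have : (\sum_(1 <= k <oo) (a k)%:E <= L%:E)%E.
  rewrite -(cvg_lim (@ereal_hausdorff R) cvg_partial); apply: lime_le.
    by apply/cvg_ex; eexists; exact: cvg_partial.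
  apply: nearW => n; rewrite lee_fin leNgt; apply/negP => /ltW Ln.
  by apply: nL; exists n.
by rewrite aoo.
Qed.

Lemma series_lty_tail : (\sum_(1 <= k <oo) (a k)%:E < +oo)%E ->
  exists r : nat -> R, [/\ forall k, (1 <= k)%N -> 0 <= r k,
    forall k, (1 <= k)%N -> a k + r k.+1 <= r k &
    forall eps, 0 < eps -> exists K, forall k, (K <= k)%N -> r k <= eps].
Proof.
move=> aoo; set S := (\sum_(1 <= k <oo) (a k)%:E)%E.
have S_ge n : ((partial n)%:E <= S)%E.
  rewrite /partial -sumEFin; apply: nneseries_lim_ge => k k1 _.
  by rewrite lee_fin a_ge0.
have S0 : (0 <= S)%E by have := S_ge 0%N; rewrite /partial big_geq.
have Sfin : S \is a fin_num by rewrite ge0_fin_numE.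
exists (fun k => fine S - partial k); split => [k _|k k1|eps eps0].
- by rewrite subr_ge0 -lee_fin fineK.
- by rewrite /partial big_nat_recr//=; lra.
have : (partial n @[n --> \oo] --> fine S).
  by have := cvg_partial; rewrite -/S -(fineK Sfin) => /fine_cvgP[_].
move=> /cvgrPdist_le /(_ _ eps0)[K _ KP]; exists K => k Kk.
by have /= := KP k Kk; exact/le_trans/ler_norm.
Qed.

End Series.

(** * Boundaries and balls in a graph *)

Section Boundary.
Variables (V : choiceType) (e : rel V).
Implicit Types (G : set V) (x : V).
Hypothesis nbrs_fin : forall x, finite_set (neighbors e setT x).

Lemma neighbors_sub G x : neighbors e G x `<=` neighbors e setT x.
Proof. by move=> y [_]. Qed.

Lemma neighbors_finite G x : finite_set (neighbors e G x).
Proof. by apply: sub_finite_set (nbrs_fin x); exact: neighbors_sub. Qed.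

(** An edge leaving G would make the neighbors in G a proper subset of a finite set, hence lower the
    degree. *)
Lemma interior_nbr G x y : G x -> ~ graph_boundary e G x -> e x y -> G y.
Proof.
move=> Gx nbd xy; apply: contrapT => nGy; apply: nbd; split => //.
rewrite /degree; apply: fproper_ltn_card; rewrite fproperEneq.
have sub : (fset_set (neighbors e G x) `<=` fset_set (neighbors e setT x))%fset.
  by rewrite -fset_set_sub//; [exact: neighbors_sub|exact: neighbors_finite].
rewrite sub andbT; apply/eqP => /fsetP/(_ y).
rewrite !in_fset_set//; last exact: neighbors_finite.
by rewrite (mem_set (_ : neighbors e setT x y))// memNset// => -[].
Qed.

Lemma boundary_exit G x : graph_boundary e G x -> exists2 y, e x y & ~ G y.
Proof.
move=> [Gx lt]; apply: contrapT => nex; move: lt; rewrite /degree.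
rewrite (_ : neighbors e G x = neighbors e setT x) ?ltnn//.
apply/seteqP; split => y [_ xy]; split => //.
by apply: contrapT => nGy; apply: nex; exists y.
Qed.

Lemma exit_boundary G x y : G x -> e x y -> ~ G y -> graph_boundary e G x.
Proof. by move=> Gx xy nGy; apply: contrapT => /(interior_nbr Gx)/(_ xy). Qed.

Lemma avg_interior (R : realType) G x (f : V -> R) :
  G x -> ~ graph_boundary e G x -> avg e G x f = avg e setT x f.
Proof.
move=> Gx nbd; rewrite /avg /degree (_ : neighbors e G x = neighbors e setT x)//.
apply/seteqP; split => y [_ xy]; split => //.
exact: interior_nbr xy.
Qed.

End Boundary.

Section GraphBall.
Variables (R : realType) (V : choiceType) (e : rel V) (o : V) (c : R).
Hypothesis c_ge1 : 1 <= c.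
Hypothesis e_sym : symmetric e.
Hypothesis V_inf : infinite_set [set: V].
Hypothesis e_conn : graph_connected e.
Hypothesis e_deg : bounded_degrees e.
Implicit Types (x y z : V) (k : nat).

Local Notation ball k := (egs_ball e o c k).
Local Notation bd k := (graph_boundary e (egs_ball e o c k)).

Lemma nbrs_fin x : finite_set (neighbors e setT x).
Proof. by have [D /(_ x) /card_le_finite] := e_deg; apply; exact: finite_II. Qed.

Lemma degree_bounded : exists2 D, (0 < D)%N & forall G x, (degree e G x <= D)%N.
Proof.
have [D DP] := e_deg; exists D.+1 => // G x; apply: leqW; apply: geq_card_fset_set.
by apply: card_le_trans (DP x); apply: subset_card_le; exact: neighbors_sub.
Qed.

Lemma graph_dist_attained x y : exists2 p, path e x p /\ last x p = y &
  graph_dist R e x y = (size p)%:R%:E.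
Proof.
pose A n := `[< exists2 p, path e x p /\ last x p = y & size p = n >].
have exA : exists n, A n.
  by have [p xp py] := e_conn x y; exists (size p); apply/asboolP; exists p.
have [n /asboolP[p xpy pn] nmin] := ex_minnP exA.
exists p => //; apply/eqP; rewrite eq_le; apply/andP; split.
  by apply: ereal_inf_lbound; exists p.
apply: le_ereal_inf_tmp => _ [q xqy <-]; rewrite lee_fin ler_nat pn.
by apply: nmin; apply/asboolP; exists q.
Qed.

Lemma ballP k x : ball k x <->
  exists p, [/\ path e o p, last o p = x & (size p)%:R <= c * k%:R].
Proof.
rewrite /egs_ball /graph_ball /=; split.
  by have [p [op px] ->] := graph_dist_attained o x; rewrite lee_fin; exists p.
case=> p [op px pk]; apply: le_trans (_ : ((size p)%:R%:E <= _)%E); last first.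
  by rewrite lee_fin; exact: pk.
by apply: ereal_inf_lbound; exists p.
Qed.

Lemma ball_center k : ball k o.
Proof. by apply/ballP; exists [::]; rewrite mulr_ge0// (le_trans _ c_ge1). Qed.

Lemma ball_nbr k x y : ball k x -> e x y -> ball k.+1 y.
Proof.
move=> /ballP[p [op px pk]] xy; apply/ballP; exists (rcons p y).
rewrite rcons_path op px xy last_rcons size_rcons; split => //.
rewrite -!natr1 mulrDr mulr1; exact: lerD.
Qed.

Lemma ball_sub k : ball k `<=` ball k.+1.
Proof.
move=> x /ballP[p [op px pk]]; apply/ballP; exists p; split => //.
by apply: le_trans pk _; rewrite ler_wpM2l ?ler_nat// (le_trans _ c_ge1).
Qed.

Lemma ball_interior_succ k x : ball k x -> ~ bd k.+1 x.
Proof.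
move=> kx /(boundary_exit)[y xy nky]; apply: nky; exact: ball_nbr xy.
Qed.

Lemma ball_finite k : finite_set (ball k).
Proof.
pose W n := [set x | exists p, [/\ path e o p, last o p = x & (size p <= n)%N]].
have finW n : finite_set (W n).
  elim: n => [|n IH].
    apply: (sub_finite_set (B := [set o])); last exact: finite_set1.
    by move=> x [p [_ <-]]; rewrite leqn0 size_eq0 => /eqP ->.
  apply: (sub_finite_set (B := W n `|` \bigcup_(x in W n) neighbors e setT x)).
    move=> x [p [+ + pn]]; move: pn; case/lastP: p => [_ _ <-|p y].
      by left; exists [::].
    rewrite size_rcons ltnS rcons_path last_rcons => pn /andP[op py] <-.
    by right; exists (last o p) => //; exists p.
  rewrite finite_setU; split => //; apply: bigcup_finite => // x _.
  exact: nbrs_fin.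
apply: sub_finite_set (finW (Num.trunc (c * k%:R))) => x /ballP[p [op px pk]].
by exists p; split => //; rewrite truncn_ge_nat// mulr_ge0// (le_trans _ c_ge1).
Qed.

Lemma graph_countable : countable [set: V].
Proof.
rewrite (_ : [set: V] = \bigcup_k ball k).
  by apply: bigcup_countable => // k _; apply: finite_set_countable; exact: ball_finite.
apply/esym/seteqP; split => // x _; have [p op px] := e_conn o x.
exists (size p) => //; apply/ballP; exists p; split => //.
by rewrite -[leLHS]mul1r ler_wpM2r.
Qed.

Lemma ball_outside k : exists v, ~ ball k v.
Proof.
apply: contrapT => nex; apply: V_inf.
apply: (sub_finite_set (B := ball k)); last exact: ball_finite.
by move=> v _; apply: contrapT => nv; apply: nex; exists v.
Qed.

Lemma center_interior k : (1 <= k)%N -> ~ bd k o.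
Proof.
move=> k1 /boundary_exit[y oy nky]; apply: nky; apply/ballP.
exists [:: y]; rewrite /= oy; split => //.
by rewrite -[leLHS]mulr1 ler_pM// ler1n.
Qed.

(** The last vertex but one on a path of length at most c k to z is reached one step earlier, so all
    its neighbors are still in the ball. This is how the walk passes from the boundary to the shell
    C_k. *)
Lemma boundary_parent k z : (1 <= k)%N -> bd k z ->
  exists2 y, neighbors e (ball k) z y & ~ bd k y.
Proof.
move=> k1 bz; have [Bz _] := bz; have /ballP[p [op pz pk]] := Bz.
move: op pz pk; case/lastP: p => [_ /= oz|p y].
  by move: bz; rewrite -oz => /(center_interior k1).
rewrite rcons_path last_rcons size_rcons => /andP[op py] yz pk.
rewrite yz in py; exists (last o p).
  split; last by rewrite e_sym.
  apply/ballP; exists p; split => //; by apply: le_trans pk; rewrite ler_nat.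
move=> /boundary_exit[y' py' nky']; apply: nky'; apply/ballP.
exists (rcons p y'); rewrite rcons_path op py' last_rcons size_rcons; split => //.
Qed.

Lemma has_nbr x : neighbors e setT x !=set0.
Proof.
have [v vx] : exists v, v <> x.
  apply: contrapT => nv; apply: V_inf.
  apply: (sub_finite_set (B := [set x])); last exact: finite_set1.
  by move=> v _; apply: contrapT => vx; apply: nv; exists v.
have [[|y p] /= xp pv] := e_conn x v; first by case: vx.
by exists y; split => //; case/andP: xp.
Qed.

Lemma walkable_setT x : walkable e setT x.
Proof. by split; [exact: nbrs_fin|exact: has_nbr]. Qed.

Lemma ball_walkable k x : (1 <= k)%N -> ball k x -> walkable e (ball k) x.
Proof.
move=> k1 kx; split; first exact: neighbors_finite nbrs_fin _ _.
have [bx|nbx] := pselect (bd k x).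
  by have [y xy _] := boundary_parent k1 bx; exists y.
have [y [_ xy]] := has_nbr x; exists y; split => //.
exact: (interior_nbr nbrs_fin) xy.
Qed.

Lemma inner_shellP k x y : bd k x -> neighbors e (ball k) x y -> ~ bd k y ->
  inner_shell e o c k y.
Proof.
move=> bx [ky xy] nby; split => //; apply/eqP; rewrite eq_le; apply/andP; split.
  apply: (@le_trans _ _ (graph_dist R e y x)).
    by apply: ereal_inf_lbound; exists x.
  by apply: ereal_inf_lbound; exists [:: x] => //=; rewrite e_sym xy.
apply: le_ereal_inf_tmp => _ [z bz <-].
have [[|z' p] /= [_ pz] ->] := graph_dist_attained y z.
  by case: nby; rewrite pz.
by rewrite lee_fin ler1n.
Qed.

(** Take psi x = q ^ l x, with l x the distance to a fixed v outside the ball. Some neighbor is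
    closer to v, so q = 1/(2 D) makes the average at least q^(l x - 1) / D = 2 q^(l x). The gain
    q^(l x) is at least q^m, where m bounds l on the ball. *)
Lemma ball_exit k : (1 <= k)%N -> exists psi : V -> R, exists2 eta : R,
  0 < eta & (forall x, psi x <= 1) /\
  forall x, ball k x -> ~ bd k x -> psi x + eta <= avg e (ball k) x psi.
Proof.
move=> k1; have [v nkv] := ball_outside k; have [D D0 DP] := degree_bounded.
pose A x n := `[< exists2 p, path e x p /\ last x p = v & size p = n >].
have exA x : exists n, A x n.
  by have [p xp py] := e_conn x v; exists (size p); apply/asboolP; exists p.
pose l x := ex_minn (exA x).
have lP x : A x (l x) by rewrite /l; case: ex_minnP.
have lmin x n : A x n -> (l x <= n)%N.
  by rewrite /l; case: ex_minnP => m _; exact.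
have bounded : exists m, forall x, ball k x -> (l x <= m)%N.
  have /finite_fsetP[X XE] := ball_finite k.
  exists (\max_(x <- X) l x) => x kx; apply: (leq_bigmax_seq (F := l)) => //.
  by have : [set` X] x by rewrite -XE.
have [m lm] := bounded; pose q : R := (2 * D%:R)^-1.
have q0 : 0 < q by rewrite invr_gt0 mulr_gt0// ltr0n.
have q1 : q <= 1.
  by rewrite invf_le1 ?mulr_gt0 ?ltr0n// -[leLHS]mulr1 ler_pM// ?ler1n// ler1n.
exists (fun x => q ^+ l x); exists (q ^+ m); first by rewrite exprn_gt0.
split=> [x|x kx nbx]; first by rewrite exprn_ile1// ltW.
rewrite (avg_interior nbrs_fin)//.
have /asboolP[[|y p] /= [xp pv] px] := lP x; first by case: nkv; rewrite -pv.
case/andP: xp => xy yp.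
have ly : (l y <= (l x).-1)%N.
  by rewrite -px; apply: lmin; apply/asboolP; exists p.
apply: (@le_trans _ _ (q ^+ (l x).-1 / D%:R)); last first.
  apply: (@le_trans _ _ (q ^+ l y / D%:R)).
    by rewrite ler_wpM2r ?invr_ge0// ler_wiXn2l// ltW.
  apply: (avg_ge_nbr (f := fun x => q ^+ l x) (walkable_setT x) (DP _ _)) => // y' _.
  by rewrite exprn_ge0// ltW.
have -> : q ^+ (l x).-1 / D%:R = q ^+ l x + q ^+ l x.
  rewrite -px /= exprS /q; field.
  by rewrite pnatr_eq0 -lt0n D0.
by rewrite lerD2l ler_wiXn2l ?lm// ltW.
Qed.

End GraphBall.

(** * Hitting probabilities *)

Section Hitting.
Variables (R : realType) (V : choiceType) (e : rel V) (o : V).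
Hypothesis V_walkable : forall x, walkable e setT x.
Hypothesis V_countable : countable [set: V].
Implicit Types (A : set V) (x y : V) (z : nat -> V) (n t : nat).

(** The probability of success within n steps. A is tested before the target because [hits_before]
    demands that A be avoided up to and including the hitting time. *)
Fixpoint hit A n x : R :=
  if x \in A then 0 else if x == o then 1 else
  if n is n'.+1 then avg e setT x (hit A n') else 0.

Lemma hit_ge0 A n x : 0 <= hit A n x.
Proof.
elim: n x => [|n IH] x /=; case: ifP => // _; case: ifP => // _.
rewrite -(avg_cst 0 (V_walkable x)); apply: ler_avg => [|y _]; last exact: IH.
by case: (V_walkable x).
Qed.

(** Until it is killed at A, the walk stays in G, where it does not meet A' either. For consecutive
    balls this shows that the hitting probability grows with the ball. *)
Lemma hit_le_domain A A' (G : set V) :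
  (forall x, G x -> ~ A x -> ~ A' x) ->
  (forall x y, G x -> ~ A x -> e x y -> G y) ->
  forall n x, G x -> hit A n x <= hit A' n x.
Proof.
move=> AA' Gnbr; elim=> [|n IH] x Gx /=.
  have [/mem_set ->|nAx] := pselect (A x).
    by case: ifP => // _; case: ifP.
  by rewrite !memNset//; exact: AA'.
have [/mem_set ->|nAx] := pselect (A x); first exact: (hit_ge0 A' n.+1).
rewrite !memNset//; last exact: AA'.
case: ifP => // _; apply: ler_avg => [|y [_ xy]]; first by case: (V_walkable x).
by apply: IH; exact: Gnbr xy.
Qed.

Definition hits_upto A n : set (nat -> V) :=
  [set z | exists t, [/\ (t <= n)%N, z t = o & forall s, (s <= t)%N -> ~ A (z s)]].

Lemma depends_hits_upto A n : depends_upto n (hits_upto A n).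
Proof.
move=> z z' zz' [t [tn zo zA]]; exists t; split => //; first by rewrite -zz'.
by move=> s st; rewrite -zz' ?(leq_trans st)//; exact: zA.
Qed.

Local Notation expect := (expect e (fun _ _ => setT)).

Lemma expect_cst n t z (F : (nat -> V) -> R) (a : R) :
  (forall z', agree t z z' -> F z' = a) -> expect n t z F = a.
Proof.
elim: n t z => [|n IH] t z Fa /=; first exact: Fa.
rewrite -[RHS](avg_cst a (V_walkable (z t))); apply: eq_avg => [|y _].
  by case: (V_walkable (z t)).
apply: IH => z' zz'; apply: Fa => s st; rewrite -zz' ?update_lt//; exact: leqW.
Qed.

Lemma expect_hits A n t z :
  (forall s, (s < t)%N -> ~ A (z s) /\ z s <> o) ->
  expect n t z (fun z' => (z' \in hits_upto A (t + n))%:R) = hit A n (z t).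
Proof.
elim: n t z => [|n IH] t z before.
  rewrite /= addn0; have [Az|nAz] := pselect (A (z t)).
    rewrite (mem_set Az) memNset// => -[s []] st zo zA.
    move: st; rewrite leq_eqVlt => /predU1P[st|st]; first by apply: zA Az; rewrite st.
    by have [] := before s st.
  rewrite (memNset nAz); have [zo|/eqP zo] := eqVneq (z t) o.
    rewrite mem_set//; exists t; split => // s; rewrite leq_eqVlt => /predU1P[->//|st].
    by have [] := before s st.
  rewrite memNset// => -[s []] + so _; rewrite leq_eqVlt => /predU1P[st|st].
    by apply: zo; rewrite -st.
  by have [] := before s st.
have [Az|nAz] := pselect (A (z t)).
  rewrite [RHS]/= (mem_set Az); apply: expect_cst => z' zz'.
  rewrite memNset// => -[s []] _ zo zA; have [ts|st] := leqP t s.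
    by apply: (zA t ts); rewrite -zz'.
  by have [_] := before s st; rewrite zz'// ltnW.
have [zo|/eqP zo] := eqVneq (z t) o.
  rewrite [RHS]/= (memNset nAz) zo eqxx; apply: expect_cst => z' zz'.
  rewrite mem_set//; exists t; split; rewrite -?zz' ?leq_addr// => s st.
  rewrite -zz'//; move: st; rewrite leq_eqVlt => /predU1P[->//|st].
  by have [] := before s st.
rewrite /= (memNset nAz); case: eqP => // _; apply: eq_avg => [|y _].
  by case: (V_walkable (z t)).
rewrite addnS -addSn IH ?update_same// => s; rewrite ltnS leq_eqVlt.
case/predU1P=> [->|st]; first by rewrite update_lt.
by rewrite update_lt ?leqW//; exact: before.
Qed.

Section Law.
Variables (d : measure_display) (T : measurableType d).
Variables (PW : V -> probability T R) (W : nat -> T -> V).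
Hypothesis W_srw : forall x, simple_random_walk e x (PW x) W.

Definition hit_prob A x : R := fine (PW x [set w | hits_before o A (W ^~ w)]).

Lemma hits_beforeE A : [set w | hits_before o A (W ^~ w)] =
  \bigcup_n [set w | hits_upto A n (W ^~ w)].
Proof.
apply/seteqP; split => [w [t zo zA]|w [n _ [t [_ zo zA]]]]; last by exists t.
by exists t => //; exists t.
Qed.

Let measurable_hits_upto A n : measurable [set w | hits_upto A n (W ^~ w)].
Proof.
apply: (measurable_upto (W_srw o) V_countable (n := n)).
exact: depends_hits_upto.
Qed.

Lemma measurable_hits_before A : measurable [set w | hits_before o A (W ^~ w)].
Proof. by rewrite hits_beforeE; exact: bigcupT_measurable. Qed.

Lemma hit_probE A x :
  PW x [set w | hits_before o A (W ^~ w)] = (hit_prob A x)%:E.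
Proof.
by rewrite fineK// fin_num_measure//; exact: measurable_hits_before.
Qed.

Lemma hit_prob_ge0 A x : 0 <= hit_prob A x.
Proof. exact: fine_ge0. Qed.

Lemma hit_prob_le1 A x : hit_prob A x <= 1.
Proof.
by rewrite -lee_fin -hit_probE probability_le1//; exact: measurable_hits_before.
Qed.

(** Comparison, boundary values and harmonicity of [hit_prob] all pass to the limit from the
    recursion [hit], which avoids conditioning the path measure on its first step. *)
Lemma cvg_hit A x : hit A n x @[n --> \oo] --> hit_prob A x.
Proof.
suff : (hit A n x)%:E @[n --> \oo] --> (hit_prob A x)%:E by move=> /fine_cvgP[_].
rewrite -hit_probE hits_beforeE.
have nd : nondecreasing_seq (fun n => [set w | hits_upto A n (W ^~ w)]).
  move=> m n mn; apply/subsetPset => w [t [tm zo zA]]; exists t; split => //.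
  exact: leq_trans mn.
have mU : measurable (\bigcup_n [set w | hits_upto A n (W ^~ w)]).
  exact: bigcupT_measurable.
have := nondecreasing_cvg_mu (mu := PW x) (measurable_hits_upto A) mU nd.
rewrite (_ : _ \o _ = fun n => (hit A n x)%:E)//; apply/funext => n /=.
rewrite (prob_upto (G := fun _ _ => setT) _ _ (W_srw x) V_countable
  (@depends_hits_upto A n)); [|by []|by move=> *; exact: V_walkable].
by rewrite expect_hits.
Qed.

Lemma hit_prob_le_domain A A' (G : set V) :
  (forall x, G x -> ~ A x -> ~ A' x) ->
  (forall x y, G x -> ~ A x -> e x y -> G y) ->
  forall x, G x -> hit_prob A x <= hit_prob A' x.
Proof.
move=> AA' Gnbr x Gx; apply: (ler_cvg_to (@cvg_hit A x) (@cvg_hit A' x)).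
by apply: nearW => n; exact: (hit_le_domain AA' Gnbr).
Qed.

Lemma hit_prob_target A : ~ A o -> hit_prob A o = 1.
Proof.
move=> nAo; apply: (cvg_unique _ (@cvg_hit A o)) => //.
rewrite (_ : (fun n => hit A n o) = fun=> 1); first exact: cvg_cst.
by apply/funext => -[|n] /=; rewrite memNset// eqxx.
Qed.

Lemma hit_prob_killed A x : A x -> hit_prob A x = 0.
Proof.
move=> Ax; apply: (cvg_unique _ (@cvg_hit A x)) => //.
rewrite (_ : (fun n => hit A n x) = fun=> 0); first exact: cvg_cst.
by apply/funext => -[|n] /=; rewrite mem_set.
Qed.

Lemma hit_prob_harmonic A x : ~ A x -> x <> o ->
  hit_prob A x = avg e setT x (hit_prob A).
Proof.
move=> nAx xo; have := @cvg_hit A x; rewrite -cvg_shiftS /= => cS.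
apply: (cvg_unique _ cS) => //=.
rewrite (_ : (fun n => _) = fun n => avg e setT x (hit A n)); last first.
  by apply/funext => n; rewrite memNset//; case: eqP.
apply: cvgM; first exact: cvg_cst.
apply: cvg_big => [|y _]; first exact: add_continuous.
exact: cvg_hit.
Qed.

End Law.
End Hitting.

Lemma eq_eseries_from (R : realType) (f g : nat -> \bar R) (m : nat) :
  (forall k, (m <= k)%N -> f k = g k) ->
  (\sum_(m <= k <oo) f k = \sum_(m <= k <oo) g k)%E.
Proof.
move=> fg; rewrite (_ : (fun n => \sum_(m <= k < n) f k)%E =
  (fun n => \sum_(m <= k < n) g k)%E)//.
by apply/funext => n; apply: eq_big_nat => k /andP[mk _]; exact: fg.
Qed.

(** * The EGS on a general graph *)

Section GraphEGS.
Variables (R : realType) (c : R) (N : nat -> nat).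
Hypothesis c_ge1 : 1 <= c.
Hypothesis N_ge1 : forall k, (1 <= k)%N -> (1 <= N k)%N.
Variables (V : choiceType) (e : rel V) (o : V).
Hypothesis e_sym : symmetric e.
Hypothesis V_inf : infinite_set [set: V].
Hypothesis e_conn : graph_connected e.
Hypothesis e_deg : bounded_degrees e.
Variables (dW : measure_display) (TW : measurableType dW).
Variables (PW : V -> probability TW R) (W : nat -> TW -> V).
Hypothesis W_srw : forall x : V, simple_random_walk e x (PW x) W.
Variables (dT : measure_display) (T : measurableType dT).
Variables (P : probability T R) (Z : nat -> T -> V).
Hypothesis Z_egs : EGS e (egs_ball e o c) N o P Z.
Implicit Types (k : nat) (x y : V).

Local Notation ball k := (egs_ball e o c k).
Local Notation bd k := (graph_boundary e (egs_ball e o c k)).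
Local Notation shell k := (inner_shell e o c k).
Local Notation u k := (hit_prob o PW W (bd k)).
Local Notation hit_set k := [set w | hits_before o (bd k) (W ^~ w)].

Let fin_nbrs : forall x, finite_set (neighbors e setT x) := nbrs_fin e_deg.
Let walkT : forall x, walkable e setT x := walkable_setT V_inf e_conn e_deg.
Let V_countable : countable [set: V] := graph_countable o c_ge1 e_conn e_deg.

Let uE k x : PW x (hit_set k) = (u k x)%:E.
Proof. exact: (hit_probE o V_countable W_srw). Qed.

Let u_ge0 k x : 0 <= u k x.
Proof. exact: hit_prob_ge0. Qed.

Let u_le1 k x : u k x <= 1.
Proof. exact: (hit_prob_le1 o V_countable W_srw). Qed.

Let u_le_succ k x : ball k x -> u k x <= u k.+1 x.
Proof.
move: x; apply: (hit_prob_le_domain o walkT V_countable W_srw) => [x kx _|x y kx nbx xy].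
  exact: (ball_interior_succ c_ge1 e_conn kx).
exact: (interior_nbr fin_nbrs kx nbx).
Qed.

Lemma boundary_nonempty k : bd k !=set0.
Proof.
have [v nkv] := ball_outside o c_ge1 V_inf e_conn e_deg k.
have [p op pv] := e_conn o v.
suff main x q : path e x q -> last x q = v -> ball k x -> bd k !=set0.
  exact: main op pv (ball_center o c_ge1 e_conn k).
elim: q x => [x _ /= ->//|y q IH x /= /andP[xy yq] qv kx].
have [ky|nky] := pselect (ball k y); first exact: IH yq qv ky.
by exists x; exact: (exit_boundary fin_nbrs) xy nky.
Qed.

(** On an empty shell the infimum in the first series would be +oo and the supremum in the second
    one -oo. *)
Lemma inner_shell_nonempty k : (1 <= k)%N -> shell k !=set0.
Proof.
move=> k1; have [x bx] := boundary_nonempty k.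
have [y xy nby] := boundary_parent c_ge1 e_sym e_conn k1 bx.
by exists y; exact: (inner_shellP e_sym e_conn bx).
Qed.

Let P_exit : forall k, (1 <= k)%N -> exists psi : V -> R, exists2 eta : R,
  0 < eta & (forall x, psi x <= 1) /\
  forall x, ball k x -> ~ bd k x -> psi x + eta <= avg e (ball k) x psi.
Proof. by move=> k; exact: ball_exit. Qed.

Let B_le k : (1 <= k)%N -> ball k `<=` ball k.+1.
Proof. by move=> _; exact: ball_sub. Qed.

Let B_walkable k x : (1 <= k)%N -> ball k x -> walkable e (ball k) x.
Proof. exact: ball_walkable. Qed.

(** On the boundary u k = 0, and a step leads with probability at least 1/D to a parent in C_k,
    where u k is at least the infimum I k. Hence p k = I k / D; the inequality u k <= u k.+1 on the
    k-th ball settles the change of stage. *)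
Lemma graph_as_recurrent :
  (\sum_(1 <= k <oo) ((N k)%:R%:E *
     ereal_inf [set PW x (hit_set k) | x in shell k]))%E = +oo%E ->
  as_recurrent o P Z.
Proof.
pose I k := ereal_inf [set PW x (hit_set k) | x in shell k].
have I0 k : (0 <= I k)%E by apply: le_ereal_inf_tmp => _ [x _ <-].
have Ifin k : (1 <= k)%N -> I k = (fine (I k))%:E.
  move=> k1; rewrite fineK// ge0_fin_numE//.
  have [x kx] := inner_shell_nonempty k1.
  apply: le_lt_trans (_ : (PW x (hit_set k) < +oo)%E); last by rewrite uE ltry.
  by apply: ereal_inf_lbound; exists x.
have fI0 k : 0 <= fine (I k) by rewrite fine_ge0.
have I_le k x : (1 <= k)%N -> shell k x -> fine (I k) <= u k x.
  by move=> k1 kx; rewrite -lee_fin -Ifin// -uE; apply: ereal_inf_lbound; exists x.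
have [D D0 DP] := degree_bounded e_deg.
move=> sumoo; have {}sumoo : (\sum_(1 <= k <oo) ((N k)%:R * fine (I k))%:E = +oo)%E.
  by rewrite -[RHS]sumoo; apply: eq_eseries_from => k k1; rewrite EFinM -Ifin.
have k0 : (1 <= 1)%N by [].
apply: (as_recurrent_criterion V_countable N_ge1 (ball_center o c_ge1 e_conn 1)
  B_le B_walkable P_exit Z_egs (g := fun k => u k) (C := 1)
  (p := fun k => fine (I k) / D%:R) k0) => //.
- by move=> k _; rewrite divr_ge0.
- move=> k x k1 kx nbx xo; rewrite (avg_interior fin_nbrs)//.
  by rewrite -(hit_prob_harmonic walkT V_countable W_srw).
- move=> k x k1 bx xo; rewrite (hit_prob_killed o walkT V_countable W_srw bx) add0r.
  have [y xy nby] := boundary_parent c_ge1 e_sym e_conn k1 bx.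
  have ky := inner_shellP e_sym e_conn bx xy nby.
  have kx : ball k x by case: bx.
  have le_avg q : u k y <= u q y -> fine (I k) / D%:R <= avg e (ball k) x (u q).
    move=> kq; apply: (@le_trans _ _ (u q y / D%:R)).
      by rewrite ler_wpM2r ?invr_ge0// (le_trans (I_le _ _ k1 ky)).
    by apply: avg_ge_nbr => //; exact: B_walkable.
  by split; apply: le_avg => //; apply: u_le_succ; case: xy.
- move=> L; have [|n Ln] := series_pinfty_partial _ sumoo (L * D%:R).
    by move=> k _; rewrite mulr_ge0.
  exists n; under eq_bigr do rewrite mulrA.
  by rewrite -mulr_suml ler_pdivlMr// ltr0n.
Qed.

(** A step from the boundary ends on the boundary, where u k = 0, or in C_k, where u k <= u k.+1 <=
    s k. As f k vanishes on the k-th boundary, only the tail r has to be small there. The criterion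
    is applied from stage 2 on, since f k refers to s k.-1 and s is controlled for positive
    indices. *)
Lemma graph_as_transient :
  (\sum_(1 <= k <oo) ((N k)%:R%:E *
     ereal_sup [set PW x (hit_set k.+1) | x in shell k]) < +oo)%E ->
  as_transient o P Z.
Proof.
pose S k := ereal_sup [set PW x (hit_set k.+1) | x in shell k].
have S_ge k x : shell k x -> ((u k.+1 x)%:E <= S k)%E.
  by move=> kx; rewrite -uE; apply: ereal_sup_ubound; exists x.
have S0 k : (1 <= k)%N -> (0 <= S k)%E.
  move=> k1; have [x kx] := inner_shell_nonempty k1.
  by apply: le_trans (S_ge _ _ kx); rewrite lee_fin u_ge0.
have Sfin k : (1 <= k)%N -> S k = (fine (S k))%:E.
  move=> k1; rewrite fineK// ge0_fin_numE ?S0//.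
  apply: le_lt_trans (ltry 1); apply: ge_ereal_sup => _ [x _ <-].
  by rewrite uE lee_fin u_le1.
pose s k := fine (S k).
have s0 k : (1 <= k)%N -> 0 <= s k by move=> k1; rewrite fine_ge0 ?S0.
have s_ge k x : (1 <= k)%N -> shell k x -> u k.+1 x <= s k.
  by move=> k1 kx; rewrite -lee_fin -Sfin// S_ge.
move=> sum_lt; have {}sum_lt : (\sum_(1 <= k <oo) ((N k)%:R * s k)%:E < +oo)%E.
  rewrite (_ : (\sum_(1 <= k <oo) _)%E = (\sum_(1 <= k <oo) ((N k)%:R%:E * S k))%E)//.
  by apply: eq_eseries_from => k k1; rewrite EFinM -Sfin.
have [|r [r0 rS r_small]] := series_lty_tail _ sum_lt.
  by move=> k k1; rewrite mulr_ge0 ?s0.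
(* Outside the interior of [ball (k - 1)] the hitting probability is truncated
   at the supremum [s (k - 1)]: this stays superharmonic and spares the maximum
   principle. *)
pose inside k x := `[< ball k x /\ ~ bd k x >].
pose f k x := if inside k.-1 x then u k x else Num.min (u k x) (s k.-1).
have f_le k x : f k x <= u k x.
  by rewrite /f; case: ifP => // _; rewrite ge_min lexx.
have f_nbr k x y : (1 <= k)%N -> bd k x -> neighbors e (ball k) x y -> f k.+1 y <= s k.
  move=> k1 bx xy; rewrite /f /=; case: ifPn => [/asboolP[ky nby]|_].
    by apply: s_ge => //; exact: (inner_shellP e_sym e_conn bx).
  by rewrite ge_min lexx orbT.
have f0 k x : (2 <= k)%N -> 0 <= f k x.
  move=> k2; rewrite /f; case: ifP => // _; rewrite le_min u_ge0 s0//.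
  by case: k k2 => [|[]].
have k1_of k : (2 <= k)%N -> (1 <= k)%N by exact: ltnW.
apply: (as_transient_criterion V_countable N_ge1 (ball_center o c_ge1 e_conn 1)
  B_le B_walkable P_exit Z_egs (f := f) (s := s) (r := r) (k0 := 2)) => //.
- case=> [|[|k]]// _; rewrite /f /= (_ : inside _ _ = true); last first.
    by apply/asboolP; split; [exact: ball_center|exact: center_interior].
  rewrite (hit_prob_target walkT V_countable W_srw)//.
  exact: (center_interior c_ge1 e_conn).
- by move=> k /k1_of /s0.
- by move=> k /k1_of /r0.
- by move=> k /k1_of /rS.
- case=> [|[|k]]// x _ kx nbx xo; have xE : u k.+2 x = avg e (ball k.+2) x (u k.+2).
    rewrite (avg_interior fin_nbrs)//.
    exact: (hit_prob_harmonic walkT V_countable W_srw).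
  have fin := neighbors_finite fin_nbrs (ball k.+2) x.
  have avg_le : avg e (ball k.+2) x (f k.+2) <= u k.+2 x.
    by rewrite xE; apply: ler_avg => // y _; exact: f_le.
  rewrite {2}/f; case: ifPn => // nin; rewrite le_min avg_le /=.
  have w : walkable e (ball k.+2) x by exact: B_walkable.
  rewrite -[leRHS](avg_cst (s k.+1) w); apply: ler_avg => // y [ky xy].
  rewrite /f /=; case: ifPn => [/asboolP[ky' nby]|_]; last by rewrite ge_min lexx orbT.
  (* A neighbor y inside the previous ball forces x onto the boundary of that ball, hence y into its
     shell, where s bounds u. *)
  have yx : e y x by rewrite e_sym.
  have kx' : ball k.+1 x by exact: (interior_nbr fin_nbrs ky' nby).
  have bx : bd k.+1 x.
    by apply: contrapT => nbx'; move/asboolP: nin; apply.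
  by apply: s_ge => //; apply: (inner_shellP e_sym e_conn bx).
- move=> k x y k2 bx xy; have k1 := k1_of _ k2.
  have fs : s k <= f k x + s k by rewrite lerDr f0.
  split; last exact: le_trans (f_nbr _ _ _ k1 bx xy) fs.
  apply: le_trans fs; apply: le_trans (f_le _ _) _.
  have [by_|nby] := pselect (bd k y).
    by rewrite (hit_prob_killed o walkT V_countable W_srw)// s0.
  apply: le_trans (u_le_succ _) _; first by case: xy.
  by apply: s_ge => //; exact: (inner_shellP e_sym e_conn bx).
- move=> eps eps0; have [K KP] := r_small _ eps0.
  exists (maxn 2 K); first exact: leq_maxl.
  move=> x bx; rewrite -[leRHS]add0r lerD ?KP ?leq_maxr//.
  by apply: le_trans (f_le _ _) _; rewrite (hit_prob_killed o walkT V_countable W_srw).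
Qed.

End GraphEGS.

(** * The lattice *)

Section Expansion.
Variable R : realType.
Implicit Types (t w : R) (m : nat).

(** The Taylor polynomial of degree 3 at 0 of (1 + t)^(-m/2). *)
Definition taylor3 m t : R :=
  1 - m%:R / 2 * t + m%:R * (m%:R + 2) / 8 * t ^+ 2
  - m%:R * (m%:R + 2) * (m%:R + 4) / 48 * t ^+ 3.

Lemma taylor3_bound m : exists2 b : R, 0 <= b &
  forall t, `|t| <= 2^-1 -> `|taylor3 m t - 1| <= b * `|t|.
Proof.
exists (m%:R / 2 + m%:R * (m%:R + 2) / 8 + m%:R * (m%:R + 2) * (m%:R + 4) / 48).
  by rewrite !addr_ge0// !mulr_ge0// ?addr_ge0.
move=> t t2; have t1 : `|t| <= 1 by lra.
set a := _ / 2; set b := _ / 8; set c := _ / 48.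
have a0 : 0 <= a by rewrite mulr_ge0.
have b0 : 0 <= b by rewrite !mulr_ge0// addr_ge0.
have c0 : 0 <= c by rewrite !mulr_ge0// addr_ge0.
rewrite /taylor3 -/a -/b -/c; clearbody a b c.
have -> : 1 - a * t + b * t ^+ 2 - c * t ^+ 3 - 1 = t * (- a + b * t - c * t ^+ 2).
  by ring.
rewrite normrM mulrC ler_wpM2r//; apply: le_trans (ler_normB _ _) _.
apply: lerD; first apply: le_trans (ler_normD _ _) _.
  rewrite normrN normrM (ger0_norm a0) (ger0_norm b0) lerD2l.
  by rewrite -[leRHS]mulr1 ler_wpM2l.
rewrite normrM (ger0_norm c0) normrX -[leRHS]mulr1 ler_wpM2l//.
by rewrite exprn_ile1.
Qed.

Lemma sqrt_range w t : 0 < w -> w ^+ 2 = 1 + t -> `|t| <= 2^-1 ->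
  2^-1 <= w <= 3 / 2.
Proof.
move=> w0 wt; rewrite ler_norml => /andP[t1 t2]; apply/andP; split.
  rewrite leNgt; apply/negP => w2.
  have : w ^+ 2 < 2^-1 ^+ 2 by rewrite ltr_pXn2r// nnegrE ?ltW// invr_gt0.
  rewrite wt expr2; lra.
rewrite leNgt; apply/negP => w2.
have : (3 / 2) ^+ 2 < w ^+ 2 by rewrite ltr_pXn2r// nnegrE ?ltW// divr_gt0.
rewrite wt expr2; lra.
Qed.

(** Substituting t = w^2 - 1 makes the remainder rational in w. It vanishes to fourth order at w =
    1, so (w - 1)^4 splits off, and t^4 = (w - 1)^4 (w + 1)^4 dominates it. *)
Lemma taylor3_inv w t : 0 < w -> w ^+ 2 = 1 + t -> `|t| <= 2^-1 ->
  `|w^-1 - taylor3 1 t| <= 16 * t ^+ 4.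
Proof.
move=> w0 wt t2; have /andP[w1 w2] := sqrt_range w0 wt t2.
have wu : w != 0 by rewrite gt_eqF.
have tE : t = w ^+ 2 - 1 by rewrite wt; ring.
pose q := 5 * w ^+ 3 + 20 * w ^+ 2 + 29 * w + 16.
have -> : w^-1 - taylor3 1 t = w^-1 * ((w - 1) ^+ 4 * q / 16).
  by rewrite /taylor3 tE /q; field.
have q0 : 0 <= q by rewrite /q !addr_ge0 ?mulr_ge0 ?exprn_ge0 ?ltW.
have q128 : q <= 128.
  have w2' : w ^+ 2 <= 9 / 4 by rewrite expr2; nra.
  have w3' : w ^+ 3 <= 27 / 8 by rewrite exprS; nra.
  by rewrite /q; lra.
have wi : w^-1 <= 2 by rewrite -[leRHS]invrK lef_pV2 ?posrE ?invr_gt0.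
have p4 : 0 <= (w - 1) ^+ 4 by rewrite exprn_even_ge0.
have wi0 : 0 <= w^-1 by rewrite invr_ge0 ltW.
have pq0 : 0 <= (w - 1) ^+ 4 * q / 16 by rewrite divr_ge0// mulr_ge0.
rewrite ger0_norm; last exact: mulr_ge0.
apply: (@le_trans _ _ (2 * ((w - 1) ^+ 4 * 128 / 16))).
  by apply: ler_pM => //; rewrite ler_wpM2r// ler_wpM2l.
have -> : t ^+ 4 = (w - 1) ^+ 4 * (w + 1) ^+ 4 by rewrite tE; ring.
have : 1 <= (w + 1) ^+ 4 by rewrite exprn_ege1// lerDr ltW.
nra.
Qed.

(** By induction on m, multiplying by w^-1: the product of the two Taylor polynomials agrees with
    the next one up to order 3. No derivatives of powers are involved. *)
Lemma taylor3_pow m : exists2 C : R, 0 <= C & forall w t,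
  0 < w -> w ^+ 2 = 1 + t -> `|t| <= 2^-1 ->
  `|w ^- m - taylor3 m t| <= C * t ^+ 4.
Proof.
elim: m => [|m [C C0 IH]].
  exists 0 => // w t _ _ _; rewrite expr0 invr1.
  rewrite (_ : taylor3 0 t = 1) ?subrr ?normr0 ?mul0r//.
  by rewrite /taylor3; ring.
have [b b0 bP] := taylor3_bound m.
pose x : R := m%:R; have x0 : 0 <= x by [].
(* The coefficients of t^4, t^5 and t^6 in [taylor3 m t * taylor3 1 t]. *)
pose k4 : R := 5 / 32 * x + 3 / 64 * (x * (x + 2)) + x * (x + 2) * (x + 4) / 96.
pose k5 : R := - (5 / 128 * (x * (x + 2))) - x * (x + 2) * (x + 4) / 128.
pose k6 : R := 5 / 768 * (x * (x + 2) * (x + 4)).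
have prodE t : taylor3 m t * taylor3 1 t - taylor3 m.+1 t =
    t ^+ 4 * (k4 + k5 * t + k6 * t ^+ 2).
  by rewrite /taylor3 /k4 /k5 /k6 -natr1 -/x; field.
exists (2 * C + 16 * (1 + b) + (`|k4| + `|k5| + `|k6|)).
  by rewrite !addr_ge0// !mulr_ge0// addr_ge0.
move=> w t w0 wt t2; have t4 : 0 <= t ^+ 4 by rewrite exprn_even_ge0.
have /andP[w1 _] := sqrt_range w0 wt t2.
have wi : w^-1 <= 2 by rewrite -[leRHS]invrK lef_pV2 ?posrE ?invr_gt0.
have -> : w ^- m.+1 - taylor3 m.+1 t = (w ^- m - taylor3 m t) * w^-1 +
    taylor3 m t * (w^-1 - taylor3 1 t) + t ^+ 4 * (k4 + k5 * t + k6 * t ^+ 2).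
  by rewrite -prodE exprS invfM; ring.
rewrite [leRHS]mulrDl [X in _ <= X + _]mulrDl.
apply: le_trans (ler_normD _ _) _; apply: lerD.
  apply: le_trans (ler_normD _ _) _; apply: lerD; rewrite normrM.
    have wi0 : 0 <= w^-1 by rewrite invr_ge0 ltW.
    rewrite (ger0_norm wi0) mulrC -mulrA.
    by apply: ler_pM => //; exact: IH.
  rewrite -mulrA mulrCA; apply: ler_pM => //; last exact: taylor3_inv.
  have := bP t t2; have := ler_normD (taylor3 m t - 1) 1.
  by rewrite subrK normr1; nra.
rewrite normrM (ger0_norm t4) mulrC ler_wpM2r//.
apply: le_trans (ler_normD _ _) _; apply: lerD.
  apply: le_trans (ler_normD _ _) _; rewrite lerD2l normrM.
  by rewrite -[leRHS]mulr1 ler_wpM2l//; lra.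
rewrite normrM normrX -[leRHS]mulr1 ler_wpM2l// exprn_ile1//; lra.
Qed.

End Expansion.

(** * Steps and squared norms on the lattice *)

Section Lattice.
Variables (R : realType) (d : nat).
Implicit Types (x y : 'rV[int]_d) (p : 'I_d * bool) (r : R).

Definition unit_step p : 'rV[int]_d := (-1) ^+ p.2 *: delta_mx ord0 p.1.

Lemma unit_stepE p i : unit_step p ord0 i = (-1) ^+ p.2 * (i == p.1)%:R.
Proof. by rewrite !mxE eqxx. Qed.

Lemma unit_step_inj : injective unit_step.
Proof.
move=> [i b] [j b'] ij; have := congr1 (fun z : 'rV[int]_d => z ord0 i) ij.
rewrite !unit_stepE /= eqxx; case: eqVneq => [<-|_].
  by rewrite !mulr1; case: b b' {ij} => -[].
by rewrite mulr0 mulr1 => /eqP; rewrite signr_eq0.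
Qed.

Lemma Zd_adj_step x p : Zd_adj x (x + unit_step p).
Proof.
rewrite /Zd_adj (bigD1 p.1)//= big1 => [|i ip].
  rewrite !mxE !eqxx opprD addNKr normrN normrM normrX normrN1 expr1n.
  by rewrite normr1 addr0 mulr1.
by rewrite !mxE eqxx (negbTE ip) mulr0 addr0 subrr normr0.
Qed.

Lemma Zd_adjP x y : Zd_adj x y -> exists p, y = x + unit_step p.
Proof.
move=> /eqP xy; have [i xyi] : exists i, x ord0 i != y ord0 i.
  apply/existsP; apply: contraPT xy => /existsPn xy.
  rewrite big1 => [/eqP//|i _].
  by have := xy i; rewrite negbK => /eqP ->; rewrite subrr normr0.
have xi1 : 1 <= `|x ord0 i - y ord0 i| by rewrite -gtz0_ge1 normr_gt0 subr_eq0.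
move: xy; rewrite (bigD1 i)//= => xy.
have rest0 : \sum_(j < d | j != i) `|x ord0 j - y ord0 j| = 0.
  by apply/eqP; rewrite eq_le sumr_ge0// andbT; have := xi1;
    rewrite -[X in X <= _]xy gerDl.
have xi : `|x ord0 i - y ord0 i| = 1 by move: xy; rewrite rest0 addr0.
exists (i, y ord0 i < x ord0 i); apply/rowP => j.
rewrite mxE unit_stepE /=; case: eqVneq => [->|ji]; last first.
  have /eqP := rest0; rewrite psumr_eq0// => /allP/(_ j).
  rewrite mem_index_enum ji normr_eq0 subr_eq0 => /(_ isT)/eqP ->.
  by rewrite mulr0 addr0.
rewrite mulr1; suff : y ord0 i = x ord0 i + (-1) ^+ (y ord0 i < x ord0 i)%R by [].
by move: xi; case: ltrgtP => // _ xi; rewrite ?expr1 ?expr0; lia.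
Qed.

Lemma sum_Zd_neighbors (G : set 'rV[int]_d) x (f : 'rV[int]_d -> R) :
  \sum_(y <- fset_set (neighbors (@Zd_adj d) G x)) f y =
  \sum_(p | x + unit_step p \in G) f (x + unit_step p).
Proof.
have fin : finite_set (neighbors (@Zd_adj d) G x).
  apply: (sub_finite_set (B := range (fun p => x + unit_step p))).
    by move=> y [_ /Zd_adjP[p ->]]; exists p.
  exact/finite_image/finite_finset.
rewrite -[RHS](big_map (fun p => x + unit_step p) (fun y => y \in G) f).
rewrite -big_filter; apply: perm_big; apply: uniq_perm.
- exact: fset_uniq.
- rewrite filter_uniq// map_inj_uniq ?index_enum_uniq//.
  by move=> p q /addrI/unit_step_inj.
- move=> y; rewrite in_fset_set// mem_filter; apply/idP/andP.
    rewrite inE => -[Gy /Zd_adjP[p yE]]; split; first exact: mem_set.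
    by apply/mapP; exists p; rewrite ?mem_index_enum.
  by case=> /set_mem Gy /mapP[p _ yp]; rewrite inE; split => //; rewrite yp Zd_adj_step.
Qed.

Lemma Zd_neighbors_finite (G : set 'rV[int]_d) x :
  finite_set (neighbors (@Zd_adj d) G x).
Proof.
apply: (sub_finite_set (B := range (fun p => x + unit_step p))).
  by move=> y [_ /Zd_adjP[p ->]]; exists p.
exact/finite_image/finite_finset.
Qed.

Lemma Zd_degree (G : set 'rV[int]_d) x :
  (degree (@Zd_adj d) G x)%:R = \sum_(p | x + unit_step p \in G) 1 :> R.
Proof.
by rewrite -(sum_Zd_neighbors G x (fun=> 1)) big_const_seq count_predT iter_addr addr0.
Qed.

Lemma Zd_degree_le (G : set 'rV[int]_d) x :
  (degree (@Zd_adj d) G x)%:R <= (2 * d)%:R :> R.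
Proof.
rewrite Zd_degree; apply: (@le_trans _ _ (\sum_(p : 'I_d * bool) 1)).
  by rewrite [leRHS](bigID (fun p => x + unit_step p \in G))/= lerDl sumr_ge0.
by rewrite sumr_const card_prod card_ord card_bool mulnC.
Qed.

Lemma Zd_avg (G : set 'rV[int]_d) x (f : 'rV[int]_d -> R) :
  avg (@Zd_adj d) G x f =
  (degree (@Zd_adj d) G x)%:R^-1 * \sum_(p | x + unit_step p \in G) f (x + unit_step p).
Proof. by rewrite /avg sum_Zd_neighbors. Qed.

Lemma Zd_avg_interior (G : set 'rV[int]_d) x (f : 'rV[int]_d -> R) :
  G x -> ~ graph_boundary (@Zd_adj d) G x ->
  avg (@Zd_adj d) G x f = (2 * d)%:R^-1 * \sum_p f (x + unit_step p).
Proof.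
move=> Gx nbx; rewrite (avg_interior (Zd_neighbors_finite _))// Zd_avg Zd_degree.
rewrite (eq_bigl xpredT) => [|p]; last by rewrite in_setT.
rewrite sumr_const card_prod card_ord card_bool mulnC; congr (_ * _).
by apply: eq_bigl => p; rewrite in_setT.
Qed.

Definition sqnorm x : nat := (\sum_(i < d) `|x ord0 i| ^ 2)%N.

Local Notation a x i := ((x ord0 i)%:~R : R).

Lemma sqnormE x : (sqnorm x)%:R = \sum_(i < d) a x i ^+ 2 :> R.
Proof.
rewrite natr_sum; apply: eq_bigr => i _.
by rewrite natrX natr_absz intr_norm real_normK ?num_real.
Qed.

Lemma sqnorm_step x p : (sqnorm (x + unit_step p))%:R =
  (sqnorm x)%:R + (1 + 2 * (-1) ^+ p.2 * a x p.1) :> R.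
Proof.
rewrite !sqnormE (bigD1 p.1)//= [in RHS](bigD1 p.1)//= [RHS]addrAC; congr (_ + _).
  rewrite mxE unit_stepE eqxx mulr1 rmorphD rmorph_sign /= sqrrD sqrr_sign.
  ring.
apply: eq_bigr => i ip.
by rewrite mxE unit_stepE (negbTE ip) mulr0 addr0.
Qed.

Lemma coord_le_sqnorm x i : a x i ^+ 2 <= (sqnorm x)%:R.
Proof.
by rewrite sqnormE (bigD1 i)//= lerDl sumr_ge0// => j _; exact: sqr_ge0.
Qed.

Lemma sqnorm_eq0 x : sqnorm x = 0%N -> x = 0.
Proof.
move=> x0; apply/rowP => i; rewrite mxE; apply/eqP.
have := coord_le_sqnorm x i; rewrite x0 => xi.
have : a x i ^+ 2 = 0 by apply/eqP; rewrite eq_le xi sqr_ge0.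
by move/eqP; rewrite sqrf_eq0 intr_eq0.
Qed.

(** Among all neighbors, the outward one along this coordinate has the largest norm, and the
    coordinate is at least |x| / sqrt d. So if any neighbor is missing at a boundary point, this one
    is. *)
Lemma max_coord x : (0 < d)%N -> exists2 i,
  forall j, `|a x j| <= `|a x i| & (sqnorm x)%:R <= d%:R * a x i ^+ 2.
Proof.
move=> d0; pose i0 : 'I_d := Ordinal d0.
pose i := [arg max_(i > i0) `|x ord0 i|%N]%N.
have imax j : `|a x j| <= `|a x i|.
  rewrite -!intr_norm -!natr_absz ler_nat /i.
  by case: arg_maxnP => // k _; apply.
exists i => //.
rewrite sqnormE; apply: (@le_trans _ _ (\sum_(j < d) a x i ^+ 2)).
  apply: ler_sum => j _; rewrite -![a x _ ^+ 2]real_normK ?num_real//.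
  by rewrite lerXn2r ?nnegrE.
by rewrite sumr_const card_ord mulr_natl.
Qed.

(* The neighbor of [x] obtained by changing the [i]-th coordinate away from 0,
   resp. towards 0. *)
Definition outward x i : 'I_d * bool := (i, x ord0 i < 0).
Definition inward x i : 'I_d * bool := (i, 0 < x ord0 i).

Lemma sqnorm_outward x i :
  (sqnorm (x + unit_step (outward x i)))%:R = (sqnorm x)%:R + (1 + 2 * `|a x i|) :> R.
Proof.
rewrite sqnorm_step /=; congr (_ + (1 + _)); rewrite -mulrA; congr (2 * _).
by case: ltrP => [x0|x0]; rewrite ?mulN1r ?mul1r -intr_norm;
  [rewrite ltr0_norm// rmorphN|rewrite ger0_norm].
Qed.

Lemma sqnorm_inward x i : x ord0 i != 0 ->
  (sqnorm (x + unit_step (inward x i)) <= (sqnorm x).-1)%N.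
Proof.
move=> xi0; have s0 : (0 < sqnorm x)%N.
  by rewrite lt0n; apply: contraNneq xi0 => /sqnorm_eq0 ->; rewrite mxE.
rewrite -ltnS prednK// -(ltr_nat R) sqnorm_step /=.
have : 1 <= `|a x i| by rewrite -intr_norm -[1]/(1%:~R) ler_int -gtz0_ge1 normr_gt0.
case: (ltrP 0 (x ord0 i)) => [x0|x0]; rewrite -intr_norm.
  by rewrite (gtr0_norm x0) => ?; rewrite expr1; lra.
by rewrite (ler0_norm x0) rmorphN /= => ?; rewrite expr0; lra.
Qed.

Lemma sqnorm_step_bound x p :
  `|1 + 2 * (-1) ^+ p.2 * a x p.1| <= 1 + 2 * `|a x p.1|.
Proof.
apply: le_trans (ler_normD _ _) _; rewrite normr1 lerD2l -mulrA !normrM normrX normrN1.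
by rewrite expr1n mul1r ger0_norm.
Qed.

Lemma sum_steps x (f : R -> R) :
  \sum_(p : 'I_d * bool) f (1 + 2 * (-1) ^+ p.2 * a x p.1) =
  \sum_(i < d) (f (1 + 2 * a x i) + f (1 - 2 * a x i)).
Proof.
rewrite -(pair_bigA _ (fun i (b : bool) => f (1 + 2 * (-1) ^+ b * a x i)))/=.
apply: eq_bigr => i _; rewrite big_bool [LHS]addrC /= expr1 expr0.
by congr (f _ + f _); ring.
Qed.

Lemma Zd_ballP r x : 0 <= r -> Zd_ball r x <-> (sqnorm x)%:R <= r ^+ 2.
Proof.
move=> r0; rewrite /Zd_ball /= sqnormE.
have s0 : 0 <= \sum_(i < d) a x i ^+ 2 by apply: sumr_ge0 => i _; exact: sqr_ge0.
rewrite -(ler_pXn2r (_ : 0 < 2)%N) ?nnegrE ?sqrtr_ge0//.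
by rewrite sqr_sqrtr.
Qed.

End Lattice.

(** * The EGS on the lattice, for an unspecified radial function *)

Section LatticeEGS.
Variables (R : realType) (d : nat) (c : R) (N : nat -> nat).
Hypothesis d_gt0 : (0 < d)%N.
Hypothesis c_ge1 : 1 <= c.
Hypothesis N_ge1 : forall k, (1 <= k)%N -> (1 <= N k)%N.
Variables (dT : measure_display) (T : measurableType dT).
Variables (P : probability T R) (Z : nat -> T -> 'rV[int]_d).
Local Notation B := (fun k : nat => Zd_ball (c * k%:R) : set 'rV[int]_d).
Local Notation bd k := (graph_boundary (@Zd_adj d) (B k)).
Local Notation n2 x := ((sqnorm x)%:R : R).
Local Notation a x i := ((x ord0 i)%:~R : R).
Hypothesis Z_egs : EGS (@Zd_adj d) B N 0 P Z.
Implicit Types (x : 'rV[int]_d) (p : 'I_d * bool) (k : nat).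

Let radius_ge0 k : 0 <= c * k%:R.
Proof. by rewrite mulr_ge0// (le_trans ler01). Qed.

Let radius_ge k : k%:R <= c * k%:R.
Proof. by rewrite -[leLHS]mul1r ler_wpM2r. Qed.

Lemma lattice_ballP k x : B k x <-> n2 x <= (c * k%:R) ^+ 2.
Proof. exact: Zd_ballP. Qed.

Lemma sqnorm0 : sqnorm (0 : 'rV[int]_d) = 0%N.
Proof. by rewrite /sqnorm big1// => i _; rewrite mxE. Qed.

(** From 2 |a| <= a^2 + 1. This crude bound and its converse below are the source of the thresholds
    of the form 2 S + 2. *)
Lemma sqnorm_step_le x p : n2 (x + unit_step p) <= 2 * n2 x + 2.
Proof.
rewrite sqnorm_step; have := coord_le_sqnorm R x p.1.
have := sqnorm_step_bound R x p; rewrite ler_norml => /andP[_].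
have := sqr_ge0 (`|a x p.1| - 1); rewrite sqrrB1 real_normK ?num_real//.
by rewrite -mulr_natl; lra.
Qed.

Lemma sqnorm_le_step x p : n2 x <= 2 * n2 (x + unit_step p) + 2.
Proof.
rewrite sqnorm_step; have := coord_le_sqnorm R x p.1.
have := sqr_ge0 (a x p.1 + 2 * (-1) ^+ p.2).
by rewrite sqrrD exprMn sqrr_sign -mulr_natl; lra.
Qed.

Let B_o : B 1%N 0.
Proof. by apply/lattice_ballP; rewrite sqnorm0 sqr_ge0. Qed.

Let B_le k : (1 <= k)%N -> B k `<=` B k.+1.
Proof.
move=> _ x /lattice_ballP kx; apply/lattice_ballP; apply: le_trans kx _.
apply: lerXn2r; rewrite ?nnegrE ?radius_ge0//.
by rewrite ler_wpM2l ?ler_nat// (le_trans ler01).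
Qed.

Let B_walkable k x : (1 <= k)%N -> B k x -> walkable (@Zd_adj d) (B k) x.
Proof.
move=> k1 kx; split; first exact: Zd_neighbors_finite.
have [[i xi]|x0] := pselect (exists i, x ord0 i != 0); last first.
  pose p : 'I_d * bool := (Ordinal d_gt0, false).
  exists (x + unit_step p); split; last exact: Zd_adj_step.
  have -> : x = 0.
    apply/rowP => i; rewrite mxE; apply/eqP; apply: contra_notT x0 => xi.
    by exists i.
  apply/lattice_ballP; rewrite sqnorm_step sqnorm0 mxE mulr0 addr0 add0r.
  by rewrite exprn_ege1// (le_trans _ (radius_ge k))// ler1n.
exists (x + unit_step (inward x i)); split; last exact: Zd_adj_step.
apply/lattice_ballP; move/lattice_ballP: kx; apply: le_trans.
by rewrite ler_nat (leq_trans (sqnorm_inward R xi))// leq_pred.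
Qed.

Let interior_step k x p : B k x -> ~ bd k x -> B k (x + unit_step p).
Proof.
by move=> kx nbx; exact: (interior_nbr (@Zd_neighbors_finite d _) kx nbx (Zd_adj_step x p)).
Qed.

(** The squared norm grows by exactly 1 on average at an interior point; it is scaled so as to be at
    most 1 on the ball. *)
Let B_exit k : (1 <= k)%N -> exists psi : 'rV[int]_d -> R, exists2 eta : R,
  0 < eta & (forall x, psi x <= 1) /\
  forall x, B k x -> ~ bd k x -> psi x + eta <= avg (@Zd_adj d) (B k) x psi.
Proof.
move=> k1; have r0 : 0 < (c * k%:R) ^+ 2.
  by rewrite exprn_gt0// (lt_le_trans _ (radius_ge k))// ltr0n.
exists (fun x => if x \in B k then n2 x / (c * k%:R) ^+ 2 else 1).
exists ((c * k%:R) ^+ 2)^-1; first by rewrite invr_gt0.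
split=> [x|x kx nbx].
  by case: ifP => // /set_mem /lattice_ballP kx; rewrite ler_pdivrMr// mul1r.
rewrite Zd_avg_interior// mem_set//.
rewrite (eq_bigr (fun p => n2 (x + unit_step p) / (c * k%:R) ^+ 2)) => [|p _]; last first.
  by rewrite mem_set//; exact: interior_step.
rewrite -mulr_suml; under eq_bigr do rewrite sqnorm_step.
rewrite big_split/= sumr_const card_prod card_ord card_bool.
rewrite (sum_steps x id)/=.
rewrite (eq_bigr (fun=> 2)) => [|i _]; last by ring.
rewrite sumr_const card_ord -[n2 x *+ _]mulr_natl -[2 *+ _]mulr_natl.
rewrite le_eqVlt; apply/orP; left; apply/eqP; field.
by rewrite !pnatr_eq0 -!lt0n k1 d_gt0 gt_eqF// (lt_le_trans ltr01).
Qed.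

Let V_countable : countable [set: 'rV[int]_d].
Proof. exact: countableP. Qed.

Lemma lattice_boundary_step k x : bd k x ->
  exists p, (c * k%:R) ^+ 2 < n2 (x + unit_step p).
Proof.
move=> /boundary_exit[y /Zd_adjP[p ->] nky]; exists p => //.
by rewrite ltNge; apply/negP => /lattice_ballP.
Qed.

Lemma lattice_boundary_sqnorm k x : bd k x -> k%:R ^+ 2 <= 2 * n2 x + 2.
Proof.
move=> /lattice_boundary_step[p rp]; apply: le_trans (sqnorm_step_le x p).
by apply: le_trans (ltW rp); apply: lerXn2r; rewrite ?nnegrE ?radius_ge0.
Qed.

(** One function serves all stages, so a change of stage costs nothing extra. Dividing by phi 0
    normalizes it to 1 at the target. *)
Lemma lattice_as_transient (phi : R -> R) (C : R) :
  0 <= C -> (forall s, 0 <= s -> 0 < phi s) ->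
  (forall x, x <> 0 ->
    \sum_p phi (n2 (x + unit_step p)) <= (2 * d)%:R * phi (n2 x)) ->
  (forall k x p, (1 <= k)%N -> k%:R ^+ 2 <= 2 * n2 x + 2 ->
    phi (n2 (x + unit_step p)) <= phi (n2 x) + C * k%:R ^- d.-1) ->
  (forall eps, 0 < eps -> exists K, forall k x, (K <= k)%N -> (1 <= k)%N ->
    k%:R ^+ 2 <= 2 * n2 x + 2 -> phi (n2 x) <= eps) ->
  (\sum_(1 <= k <oo) ((N k)%:R * k%:R ^- d.-1 : R)%:E < +oo)%E ->
  as_transient 0 P Z.
Proof.
move=> C0 phi0 phi_super phi_step phi_small sum_lt.
have [|r [r0 rS r_small]] := series_lty_tail _ sum_lt.
  by move=> k _; rewrite mulr_ge0// invr_ge0 exprn_ge0.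
have p0 : 0 < phi 0 by exact: phi0.
have pi0 : 0 <= (phi 0)^-1 by rewrite invr_ge0 ltW.
pose A := C / phi 0; have A0 : 0 <= A by rewrite divr_ge0// ltW.
apply: (as_transient_criterion V_countable N_ge1 B_o B_le B_walkable B_exit Z_egs
  (k0 := 1) (f := fun _ x => phi (n2 x) / phi 0)
  (s := fun k => A * k%:R ^- d.-1) (r := fun k => A * r k)) => //.
- by move=> k x _; rewrite divr_ge0// ltW// phi0.
- by move=> k _; rewrite sqnorm0 divff// gt_eqF.
- by move=> k _; rewrite mulr_ge0// invr_ge0 exprn_ge0.
- by move=> k k1; rewrite mulr_ge0// r0.
- by move=> k k1; rewrite mulrCA -mulrDr ler_wpM2l// rS.
- move=> k x k1 kx nbx xo; rewrite Zd_avg_interior// -mulr_suml mulrA.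
  rewrite ler_wpM2r// mulrC ler_pdivrMr ?ltr0n ?muln_gt0//.
  by rewrite mulrC phi_super.
- move=> k x y k1 bx [_ /Zd_adjP[p ->]]; rewrite /A mulrAC -mulrDl.
  have := phi_step _ _ p k1 (lattice_boundary_sqnorm bx) => h.
  by rewrite ler_wpM2r.
- move=> eps eps0; have [|K1 K1P] := phi_small (eps / 2 * phi 0).
    by rewrite mulr_gt0// divr_gt0.
  (* Half of eps is left for A * r; the denominator A + 1 is positive even if A = 0. *)
  have [|K2 K2P] := r_small (eps / 2 / (A + 1)).
    by rewrite !divr_gt0// ltr_wpDl.
  exists (maxn 1 (maxn K1 K2)); first exact: leq_maxl.
  move=> x bx; set k := maxn _ _ in bx *.
  have k1 : (1 <= k)%N by exact: leq_maxl.
  have kK1 : (K1 <= k)%N by rewrite /k !leq_max leqnn orbT.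
  have kK2 : (K2 <= k)%N by rewrite /k !leq_max leqnn !orbT.
  rewrite [eps]splitr lerD//.
    by rewrite ler_pdivrMr// (K1P k)//; exact: lattice_boundary_sqnorm.
  have := K2P _ kK2; rewrite ler_pdivlMr ?ltr_wpDl// => h.
  by apply: le_trans h; rewrite mulrC ler_wpM2l ?r0// lerDl.
Qed.

(* [phi] need only be subharmonic away from 0: inside the ball [sqnorm < S1] it
   is replaced by a multiple of [(2d)^-sqnorm], which at least doubles on
   average at every [x <> 0], shifted so as to vanish at [sqnorm = S1]. *)
Lemma lattice_as_recurrent (phi : R -> R) (S0 : nat) (kappa : R) :
  (2 <= d)%N -> 0 < kappa ->
  (forall s s', S0%:R <= s -> s <= s' -> phi s' <= phi s) ->
  (forall x, (2 * S0 + 2 <= sqnorm x)%N ->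
    (2 * d)%:R * phi (n2 x) <= \sum_p phi (n2 (x + unit_step p))) ->
  (forall x i, (2 * S0 + 2 <= sqnorm x)%N -> n2 x <= d%:R * a x i ^+ 2 ->
    kappa * Num.sqrt (n2 x) ^- d.-1 <= phi (n2 x) - phi (n2 x + (1 + 2 * `|a x i|))) ->
  (forall L : R, exists n, L <= \sum_(1 <= k < n) (N k)%:R * k%:R ^- d.-1) ->
  as_recurrent 0 P Z.
Proof.
move=> d2 kappa0 phi_le phi_sub phi_drop sumoo.
(* Neighbors of points beyond S1 lie beyond S0, neighbors of points beyond S2 lie beyond S1, and
   points below S1 have neighbors up to S2 at most. From stage k1 on, boundary points lie beyond
   S2. *)
pose S1 := (2 * S0 + 2)%N; pose S2 := (2 * S1 + 2)%N; pose k1 := (2 * S2 + 2)%N.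
have S01 : (S0 <= S1)%N by rewrite /S1; lia.
have S12 : (S1 <= S2)%N by rewrite /S2; lia.
have S1_gt0 : (0 < S1)%N by rewrite /S1 addn2.
have k1_gt0 : (1 <= k1)%N by rewrite /k1 addn2.
have ge_S0 m n : (S1 <= m)%N -> (m <= 2 * n + 2)%N -> (S0 <= n)%N by rewrite /S1; lia.
have ge_S1 m n : (S2 <= m)%N -> (m <= 2 * n + 2)%N -> (S1 <= n)%N by rewrite /S2; lia.
have le_S2 m n : (m < S1)%N -> (n <= 2 * m + 2)%N -> (n <= S2)%N by rewrite /S2; lia.
have ge_S2 k n : (k1 <= k)%N -> (k ^ 2 <= 2 * n + 2)%N -> (S2 <= n)%N.
  by rewrite /k1; nia.
(* Subtracting K makes the outer function nonnegative between S0 and S2, hence wherever it is seen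
   from a point below S1. *)
pose D : R := (2 * d)%:R; pose K := phi S2%:R.
have D0 : 0 < D by rewrite ltr0n muln_gt0.
have D1 : 1 < D by rewrite ltr1n; lia.
pose M := phi S0%:R - K.
have M0 : 0 <= M by rewrite subr_ge0 phi_le// ler_nat (leq_trans S01).
pose w n := D ^- n.
have wS n : w n = D * w n.+1.
  by rewrite /w exprS invfM mulrA divff ?mul1r// gt_eqF.
have w0 n : 0 < w n by rewrite invr_gt0 exprn_gt0.
have w_le m n : (m <= n)%N -> w n <= w m.
  move=> mn; rewrite lef_pV2 ?posrE ?exprn_gt0//.
  by rewrite ler_weXn2l// ltW.
have gap0 : 0 < w S1.-1 - w S1.
  rewrite (wS S1.-1) prednK; last by rewrite /S1 addn2.
  by rewrite subr_gt0 -[ltLHS]mul1r ltr_pM2r.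
(* With this C the inner function is at least M below S1, while the outer one is at most M from S0
   on. So at every neighbor of x, G is at least the branch used at x, as for a maximum of
   subharmonic functions. *)
pose C := M / (w S1.-1 - w S1).
have C0 : 0 <= C by rewrite divr_ge0// ltW.
pose G n := if (n < S1)%N then C * (w n - w S1) else phi n%:R - K.
have GM n : (n < S1)%N -> M <= C * (w n - w S1).
  move=> nS; rewrite -[leLHS](divfK (_ : w S1.-1 - w S1 != 0)) ?gt_eqF// -/C.
  by rewrite ler_wpM2l// lerD2r w_le// -ltnS prednK// (leq_ltn_trans _ nS).
have phiM n : (S0 <= n)%N -> phi n%:R - K <= M.
  by move=> nS; rewrite lerD2r phi_le// ler_nat.
have stepN x p : (sqnorm (x + unit_step p) <= 2 * sqnorm x + 2)%N.
  by rewrite -(ler_nat R) natrD natrM; exact: sqnorm_step_le.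
have stepN' x p : (sqnorm x <= 2 * sqnorm (x + unit_step p) + 2)%N.
  by rewrite -(ler_nat R) natrD natrM; exact: sqnorm_le_step.
have G_sub x : x <> 0 ->
    D * G (sqnorm x) <= \sum_p G (sqnorm (x + unit_step p)).
  move=> xo; have [xS|Sx] := ltnP (sqnorm x) S1.
    have [i xi] : exists i, x ord0 i != 0.
      apply: contra_notP xo => nx; apply/rowP => i; rewrite mxE; apply/eqP.
      by apply: contra_notT nx => xi; exists i.
    apply: (@le_trans _ _ (\sum_p C * (w (sqnorm (x + unit_step p)) - w S1))).
      rewrite /G xS -mulr_sumr mulrCA ler_wpM2l// mulrBr sumrB; apply: lerB.
        (* The inward neighbor alone accounts for D * w (sqnorm x), since w n = D * w n.+1 and w
           decreases. *)
        rewrite (bigD1 (inward x i))//= -[leLHS]addr0 lerD//; last first.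
          by apply: sumr_ge0 => p _; rewrite ltW.
        have x0 : (0 < sqnorm x)%N.
          by rewrite lt0n; apply: contra_notN xo => /eqP/sqnorm_eq0; exact.
        rewrite -{1}(prednK x0) -wS; apply: w_le.
        exact: (sqnorm_inward R xi).
      by rewrite sumr_const card_prod card_ord card_bool -mulr_natl (mulnC d).
    apply: ler_sum => p _; rewrite /G; case: ltnP => // Sp.
    apply: (@le_trans _ _ 0); first by rewrite mulr_ge0_le0// subr_le0 w_le.
    by rewrite subr_ge0 phi_le// ler_nat ?(leq_trans S01)// (le_S2 _ _ xS).
  rewrite {1}/G ltnNge Sx /=.
  apply: (@le_trans _ _ (\sum_p (phi (n2 (x + unit_step p)) - K))).
    rewrite sumrB mulrBr lerB ?phi_sub//.
    by rewrite sumr_const card_prod card_ord card_bool -mulr_natl (mulnC d).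
  apply: ler_sum => p _; rewrite /G; case: ltnP => // pS.
  by apply: le_trans (GM _ pS); apply: phiM; exact: ge_S0 Sx (stepN' _ _).
have bd_far k x : (k1 <= k)%N -> bd k x -> (S2 <= sqnorm x)%N.
  move=> kk /lattice_boundary_sqnorm; rewrite -natrX -natrM -natrD ler_nat.
  exact: ge_S2.
(* The power of c comes from |x| <= c k, and D bounds the degree in the average. *)
pose A := kappa * c ^- d.-1 / D.
have A0 : 0 < A by rewrite divr_gt0// mulr_gt0// invr_gt0 exprn_gt0// (lt_le_trans ltr01).
have G_bd k x : (k1 <= k)%N -> bd k x ->
    G (sqnorm x) + A * k%:R ^- d.-1 <=
    avg (@Zd_adj d) (B k) x (fun y => G (sqnorm y)).
  move=> kk bx; have kx : B k x by case: bx.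
  have k0 : (0 < k)%N by exact: leq_trans kk.
  have xS2 := bd_far _ _ kk bx.
  have xS1 : (S1 <= sqnorm x)%N by exact: leq_trans xS2.
  have GE : G (sqnorm x) = phi (n2 x) - K by rewrite /G ltnNge xS1.
  have GpE p : G (sqnorm (x + unit_step p)) = phi (n2 (x + unit_step p)) - K.
    by rewrite /G ltnNge (ge_S1 _ _ xS2).
  have [q rq] := lattice_boundary_step bx.
  have [i imax idn] := max_coord R x d_gt0.
  pose pm := outward x i.
  have r_pm : (c * k%:R) ^+ 2 < n2 (x + unit_step pm).
    apply: lt_le_trans rq _; rewrite sqnorm_outward sqnorm_step lerD2l.
    have qi := imax q.1.
    have := sqnorm_step_bound R x q; rewrite ler_norml => /andP[_]; lra.
  have nG p : (x + unit_step p \notin B k) = ((c * k%:R) ^+ 2 < n2 (x + unit_step p)).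
    rewrite ltNge; congr (~~ _); apply/idP/idP => [/set_mem/lattice_ballP//|].
    by move=> /lattice_ballP/mem_set.
  have x_far p : x + unit_step p \notin B k -> 0 <= phi (n2 x) - phi (n2 (x + unit_step p)).
    rewrite nG subr_ge0 => rp; apply: phi_le.
      by rewrite ler_nat (leq_trans S01).
    by apply: le_trans (ltW rp); apply/lattice_ballP.
  have drop : kappa * (c ^- d.-1 * k%:R ^- d.-1) <=
      \sum_(p | x + unit_step p \notin B k) (phi (n2 x) - phi (n2 (x + unit_step p))).
    rewrite (bigD1 pm)/=; last by rewrite nG.
    rewrite -[leLHS]addr0 lerD//; last by apply: sumr_ge0 => p /andP[/x_far].
    rewrite sqnorm_outward; apply: le_trans (phi_drop _ _ xS1 idn).
    rewrite (ler_wpM2l (ltW kappa0))// -invfM -exprMn lef_pV2 ?posrE ?exprn_gt0//.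
    - apply: lerXn2r; rewrite ?nnegrE ?sqrtr_ge0 ?radius_ge0//.
      rewrite -(ler_pXn2r (_ : 0 < 2)%N) ?nnegrE ?sqrtr_ge0 ?radius_ge0//.
      by rewrite sqr_sqrtr//; apply/lattice_ballP.
    - by rewrite (lt_le_trans _ (radius_ge k))// ltr0n.
    - by rewrite sqrtr_gt0 ltr0n (leq_trans S1_gt0).
  (* Over all 2 d steps the increments of phi sum to at least 0, and those of the missing neighbors
     sum to at most minus the drop. The remaining ones therefore sum to at least the drop. *)
  have total : 0 <= \sum_p (phi (n2 (x + unit_step p)) - phi (n2 x)).
    rewrite sumrB subr_ge0 sumr_const card_prod card_ord card_bool.
    by rewrite -[phi _ *+ _]mulr_natl (mulnC d) phi_sub.
  have deg0 : 0 < (degree (@Zd_adj d) (B k) x)%:R :> R.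
    by rewrite ltr0n; apply: degree_gt0; exact: B_walkable.
  rewrite Zd_avg [leRHS]mulrC ler_pdivlMr// GE; under eq_bigr do rewrite GpE.
  rewrite -subr_ge0; set deg := (degree _ _ _)%:R.
  have -> : \sum_(p | x + unit_step p \in B k) (phi (n2 (x + unit_step p)) - K) =
      \sum_(p | x + unit_step p \in B k) (phi (n2 (x + unit_step p)) - phi (n2 x)) +
      (phi (n2 x) - K) * deg.
    rewrite /deg Zd_degree mulr_sumr -big_split /=; apply: eq_bigr => p _.
    by rewrite mulr1 addrA subrK.
  rewrite (bigID (fun p => x + unit_step p \in B k)) /= in total.
  have dropE : \sum_(p | x + unit_step p \notin B k) (phi (n2 x) - phi (n2 (x + unit_step p))) =
      - \sum_(p | x + unit_step p \notin B k) (phi (n2 (x + unit_step p)) - phi (n2 x)).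
    by rewrite -sumrN; apply: eq_bigr => p _; rewrite opprB.
  rewrite dropE in drop.
  have degD : deg <= D by exact: Zd_degree_le.
  have kd0 : 0 <= kappa * (c ^- d.-1 * k%:R ^- d.-1).
    by rewrite mulr_ge0 ?(ltW kappa0)// -invfM -exprMn invr_ge0 exprn_ge0.
  have : A * k%:R ^- d.-1 * deg <= kappa * (c ^- d.-1 * k%:R ^- d.-1).
    rewrite (_ : _ * deg = kappa * (c ^- d.-1 * k%:R ^- d.-1) * (deg / D)).
      by rewrite ler_piMr// ler_pdivrMr// mul1r.
    by rewrite /A; ring.
  lra.
have far0 k x : (k1 <= k)%N -> bd k x -> x <> 0.
  by move=> kk /(bd_far _ _ kk) + x0; rewrite x0 sqnorm0 leqNgt (leq_trans S1_gt0).
apply: (as_recurrent_criterion V_countable N_ge1 B_o B_le B_walkable B_exit Z_egs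
  (k0 := k1) (g := fun _ x => G (sqnorm x)) (C := C + M)
  (p := fun k => A * k%:R ^- d.-1)).
- exact: k1_gt0.
- move=> k x _; rewrite /G; case: ltnP => [_|Sx].
    rewrite -[leLHS]addr0 lerD// -[leRHS]mulr1 ler_wpM2l//.
    have : w (sqnorm x) <= 1 by have := w_le _ _ (leq0n (sqnorm x)); rewrite /w expr0 invr1.
    by have := w0 S1; lra.
  by rewrite -[leLHS]add0r lerD// phiM// (leq_trans S01).
- by move=> k _; rewrite mulr_ge0 ?(ltW A0)// invr_ge0 exprn_ge0.
- move=> k x _ kx nbx xo; rewrite Zd_avg_interior// mulrC ler_pdivlMr// mulrC.
  exact: G_sub.
- by move=> k x kk bx xo; split; exact: G_bd.
(* The terms before k1 are added to the level because the criterion sums from k1 only. *)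
- move=> L; have [n Ln] := sumoo (L / A + \sum_(1 <= k < k1) (N k)%:R * k%:R ^- d.-1).
  exists (maxn n k1); under eq_bigr do rewrite mulrCA.
  rewrite -mulr_sumr mulrC -ler_pdivrMr//.
  have {}Ln : L / A + \sum_(1 <= k < k1) (N k)%:R * k%:R ^- d.-1 <=
      \sum_(1 <= k < maxn n k1) (N k)%:R * k%:R ^- d.-1.
    apply: (le_trans Ln); have [n0|n0] := posnP n.
      by rewrite n0 big_geq// sumr_ge0.
    by rewrite [leRHS](big_cat_nat n0 (leq_maxl _ _))/= lerDl sumr_ge0.
  move: Ln; rewrite [leRHS](big_cat_nat k1_gt0 (leq_maxr _ _))/=.
  by rewrite [leRHS]addrC lerD2r.
Qed.

End LatticeEGS.

(** * Radial functions on the lattice *)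

Section RadialFunctions.
Variables (R : realType) (d : nat).
Implicit Types (x : 'rV[int]_d) (p : 'I_d * bool) (m : nat).
Local Notation n2 x := ((sqnorm x)%:R : R).
Local Notation a x i := ((x ord0 i)%:~R : R).
Local Notation delta x p := (1 + 2 * (-1) ^+ p.2 * a x p.1).

Lemma sum_coord4_le x : \sum_(i < d) a x i ^+ 4 <= n2 x ^+ 2.
Proof.
rewrite expr2 {1}sqnormE mulr_suml; apply: ler_sum => i _.
rewrite (_ : 4 = 2 + 2)%N// exprD ler_wpM2l ?sqr_ge0//.
exact: coord_le_sqnorm.
Qed.

Lemma sum_delta4_le x : \sum_(p : 'I_d * bool) delta x p ^+ 4 <=
  2 * d%:R + 48 * n2 x + 32 * n2 x ^+ 2.
Proof.
rewrite (sum_steps x (fun t => t ^+ 4)).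
rewrite (eq_bigr (fun i => 2 + 48 * a x i ^+ 2 + 32 * a x i ^+ 4)) => [|i _]; last by ring.
rewrite !big_split/= sumr_const card_ord -!mulr_sumr -sqnormE.
by have := sum_coord4_le x; lra.
Qed.

(** Adding the values at 1 + 2 a and 1 - 2 a cancels odd powers of a: first, second and third powers
    give 2, 2 + 8 a^2 and 2 + 24 a^2. So up to order 3 the sum depends on x only through its
    norm. *)
Lemma sum_taylor3 m x (sigma : R) :
  \sum_(p : 'I_d * bool) taylor3 m (delta x p / sigma) =
  2 * d%:R - m%:R * d%:R / sigma
  + m%:R * (m%:R + 2) / 8 * (2 * d%:R + 8 * n2 x) / sigma ^+ 2
  - m%:R * (m%:R + 2) * (m%:R + 4) / 48 * (2 * d%:R + 24 * n2 x) / sigma ^+ 3.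
Proof.
rewrite (sum_steps x (fun t => taylor3 m (t / sigma))).
rewrite (eq_bigr (fun i => (2 - m%:R / sigma
  + m%:R * (m%:R + 2) / 8 * 2 / sigma ^+ 2
  - m%:R * (m%:R + 2) * (m%:R + 4) / 48 * 2 / sigma ^+ 3)
  + (m%:R * (m%:R + 2) / 8 * 8 / sigma ^+ 2
     - m%:R * (m%:R + 2) * (m%:R + 4) / 48 * 24 / sigma ^+ 3) * a x i ^+ 2)).
  rewrite big_split/= sumr_const card_ord -mulr_sumr -sqnormE -mulr_natr.
  by rewrite -![sigma ^- _]exprVn; move: sigma^-1 => s; field.
by move=> i _; rewrite /taylor3 -![sigma ^- _]exprVn; move: sigma^-1 => s; field.
Qed.

Lemma radial_step m x p (e sigma : R) : sigma = n2 x + e -> 0 < sigma ->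
  `|delta x p| <= sigma / 2 -> exists2 w, 0 < w &
  [/\ w ^+ 2 = 1 + delta x p / sigma, `|delta x p / sigma| <= 2^-1 &
    Num.sqrt (n2 (x + unit_step p) + e) ^- m = Num.sqrt sigma ^- m * w ^- m].
Proof.
move=> sE s0 dp; have t2 : `|delta x p / sigma| <= 2^-1.
  by rewrite normrM normfV (gtr0_norm s0) ler_pdivrMr// [leRHS]mulrC.
have w0 : 0 < 1 + delta x p / sigma.
  by move: t2; rewrite ler_norml => /andP[]; lra.
exists (Num.sqrt (1 + delta x p / sigma)); first by rewrite sqrtr_gt0.
rewrite sqr_sqrtr ?(ltW w0)//; split => //.
rewrite -invfM -exprMn -sqrtrM ?(ltW s0)//; congr (Num.sqrt _ ^- m).
rewrite (_ : sigma * _ = sigma + delta x p); last by field; rewrite gt_eqF.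
by rewrite sqnorm_step sE addrAC.
Qed.

Lemma radial_sum m : exists2 C : R, 0 <= C & forall x (e sigma : R),
  sigma = n2 x + e -> 0 < sigma -> (forall p, `|delta x p| <= sigma / 2) ->
  `|\sum_p Num.sqrt (n2 (x + unit_step p) + e) ^- m -
    Num.sqrt sigma ^- m * \sum_(p : 'I_d * bool) taylor3 m (delta x p / sigma)| <=
  Num.sqrt sigma ^- m *
    (C * (2 * d%:R + 48 * n2 x + 32 * n2 x ^+ 2) / sigma ^+ 4).
Proof.
have [C C0 CP] := taylor3_pow R m; exists C => // x e sigma sE s0 dp.
have u0 : 0 <= Num.sqrt sigma ^- m by rewrite invr_ge0 exprn_ge0// sqrtr_ge0.
apply: (@le_trans _ _ (\sum_(p : 'I_d * bool)
  Num.sqrt sigma ^- m * (C * (delta x p / sigma) ^+ 4))).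
  rewrite mulr_sumr -sumrB; apply: le_trans (ler_norm_sum _ _ _) _.
  apply: ler_sum => p _; have [w w0 [wt t2 ->]] := radial_step m sE s0 (dp p).
  by rewrite -mulrBr normrM (ger0_norm u0) ler_wpM2l// CP.
rewrite -!mulr_sumr ler_wpM2l// -mulrA ler_wpM2l//.
under eq_bigr do rewrite exprMn exprVn.
by rewrite -mulr_suml ler_wpM2r ?sum_delta4_le// invr_ge0 exprn_ge0 ?(ltW s0).
Qed.

Lemma delta_le x p : `|delta x p| <= 1 + 2 * `|a x p.1|.
Proof. exact: sqnorm_step_bound. Qed.

Lemma normr_coord_sqr x i : `|a x i| ^+ 2 <= n2 x.
Proof. by rewrite real_normK ?num_real//; exact: coord_le_sqnorm. Qed.

(** * Dimension at least three *)

Section HighDimension.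
Variable m : nat.
Hypothesis m_gt0 : (0 < m)%N.
Hypothesis dE : d = m.+2.

Let dR : d%:R = m%:R + 2 :> R.
Proof. by rewrite dE -addn2 natrD. Qed.

Let m1 : 1 <= m%:R :> R.
Proof. by rewrite ler1n. Qed.

(** Let n be the squared norm of x. Since d = m + 2 and n = sigma - e, the terms - m d / sigma and m
    (m + 2) n / sigma^2 add up to - m d e / sigma^2. The lattice errors have this same order, so a
    large e wins; the cubic term has the favorable sign. *)
Lemma radial_superharmonic : exists2 e : R, 6 <= e & forall x,
  \sum_p Num.sqrt (n2 (x + unit_step p) + e) ^- m <=
  (2 * d)%:R * Num.sqrt (n2 x + e) ^- m.
Proof.
have [C C0 CP] := radial_sum m.
(* The 6 yields 1 + 2 |a| <= sigma / 2 through (|a| - 2)^2 >= 0, d beats m d^2 / 4, and the last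
   summand beats the remainder, with 80 = 48 + 32. *)
pose e : R := 6 + d%:R + C * (2 * d%:R + 80).
have Cd0 : 0 <= C * (2 * d%:R + 80) by rewrite mulr_ge0// addr_ge0// mulr_ge0.
have e6 : 6 <= e by rewrite /e -addrA lerDl addr_ge0.
exists e => // x; set sigma := n2 x + e; have n0 : 0 <= n2 x by [].
have s6 : 6 <= sigma by rewrite /sigma; lra.
have s0 : 0 < sigma by lra.
have dp p : `|delta x p| <= sigma / 2.
  apply: le_trans (delta_le x p) _; have := normr_coord_sqr x p.1.
  have := sqr_ge0 (`|a x p.1| - 2); rewrite /sigma !expr2; nra.
have u0 : 0 <= Num.sqrt sigma ^- m by rewrite invr_ge0 exprn_ge0// sqrtr_ge0.
have := CP x e sigma erefl s0 dp; rewrite ler_norml => /andP[_].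
rewrite lerBlDr -mulrDr => /le_trans; apply; rewrite [leRHS]mulrC ler_wpM2l//.
rewrite sum_taylor3 natrM; set E := C * _ / _.
have E_le : E <= C * (2 * d%:R + 80) / sigma ^+ 2.
  rewrite /E (_ : sigma ^+ 4 = sigma ^+ 2 * sigma ^+ 2) -?exprD// exprD invfM.
  rewrite mulrA ler_wpM2r ?invr_ge0 ?sqr_ge0// ler_pdivrMr ?exprn_gt0//.
  rewrite -mulrA ler_wpM2l//.
  have ns : n2 x <= sigma by rewrite /sigma; lra.
  have d0 : 0 <= d%:R :> R by [].
  have ss : sigma <= sigma ^+ 2 by rewrite expr2 ler_peMl ?(ltW s0)//; lra.
  have ns2 : n2 x ^+ 2 <= sigma ^+ 2 by apply: lerXn2r; rewrite ?nnegrE ?(ltW s0).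
  have : d%:R <= d%:R * sigma ^+ 2 by rewrite ler_peMr//; lra.
  by rewrite mulrDl; lra.
have main : - (m%:R * d%:R / sigma) +
    m%:R * (m%:R + 2) / 8 * (2 * d%:R + 8 * n2 x) / sigma ^+ 2 =
    (m%:R * d%:R ^+ 2 / 4 - m%:R * d%:R * e) / sigma ^+ 2.
  have nE : n2 x = sigma - e by rewrite /sigma addrK.
  by rewrite -dR nE; field; rewrite gt_eqF.
have cubic : 0 <= m%:R * (m%:R + 2) * (m%:R + 4) / 48 * (2 * d%:R + 24 * n2 x) / sigma ^+ 3.
  by rewrite !mulr_ge0// ?invr_ge0 ?exprn_ge0 ?addr_ge0 ?mulr_ge0// ltW.
have quad : (m%:R * d%:R ^+ 2 / 4 - m%:R * d%:R * e) / sigma ^+ 2 +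
    C * (2 * d%:R + 80) / sigma ^+ 2 <= 0.
  rewrite -mulrDl pmulr_lle0 ?invr_gt0 ?exprn_gt0//.
  have md1 : 1 <= m%:R * d%:R :> R by rewrite dR; have := m1; nra.
  have d0 : 0 <= d%:R :> R by [].
  have -> : m%:R * d%:R ^+ 2 / 4 - m%:R * d%:R * e + C * (2 * d%:R + 80) =
    - (m%:R * d%:R * (6 + 3 / 4 * d%:R)) - (m%:R * d%:R - 1) * (C * (2 * d%:R + 80)).
    by rewrite /e; field.
  have t0 : 0 <= 6 + 3 / 4 * d%:R :> R by lra.
  have : 0 <= m%:R * d%:R * (6 + 3 / 4 * d%:R) :> R by rewrite mulr_ge0.
  have : 0 <= (m%:R * d%:R - 1) * (C * (2 * d%:R + 80)) by rewrite mulr_ge0// subr_ge0.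
  by lra.
by lra.
Qed.

(** The opposite shift leaves + m d b / sigma^2, which must outweigh the remainder and also the
    cubic term, now of unfavorable sign. Far from 0, n <= 2 sigma keeps both of order sigma^-2. *)
Lemma radial_subharmonic : exists2 b : R, 0 <= b & forall x,
  2 * b + 72 <= n2 x ->
  (2 * d)%:R * Num.sqrt (n2 x - b) ^- m <=
  \sum_p Num.sqrt (n2 (x + unit_step p) - b) ^- m.
Proof.
have [C C0 CP] := radial_sum m.
pose g : R := m%:R * (m%:R + 2) * (m%:R + 4) / 48.
have g0 : 0 <= g by rewrite !mulr_ge0// ?addr_ge0.
(* The summands match the cubic term and the remainder after n <= 2 sigma: 48 = 2 * 24 and 224 = 2 *
   48 + 4 * 32. *)
pose b : R := g * (2 * d%:R + 48) + C * (2 * d%:R + 224).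
have d0 : 0 <= d%:R :> R by [].
have D48 : 0 <= 2 * d%:R + 48 :> R by lra.
have D224 : 0 <= 2 * d%:R + 224 :> R by lra.
have b0 : 0 <= b by exact: addr_ge0 (mulr_ge0 g0 D48) (mulr_ge0 C0 D224).
exists b => // x xb; set sigma := n2 x - b.
have ns : n2 x <= 2 * sigma by rewrite /sigma; lra.
have s36 : 36 <= sigma by rewrite /sigma; lra.
have s0 : 0 < sigma by lra.
have n0 : 0 <= n2 x by [].
have dp p : `|delta x p| <= sigma / 2.
  apply: le_trans (delta_le x p) _; have := normr_coord_sqr x p.1.
  have := sqr_ge0 (`|a x p.1| - 8); rewrite !expr2; nra.
have u0 : 0 <= Num.sqrt sigma ^- m by rewrite invr_ge0 exprn_ge0// sqrtr_ge0.
have := CP x (- b) sigma erefl s0 dp; rewrite ler_norml => /andP[+ _].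
rewrite lerBrDr addrC -mulrBr; apply: le_trans; rewrite mulrC ler_wpM2l//.
rewrite sum_taylor3 natrM -/g; set E := C * _ / _.
have E_le : E <= C * (2 * d%:R + 224) / sigma ^+ 2.
  rewrite /E (_ : sigma ^+ 4 = sigma ^+ 2 * sigma ^+ 2) -?exprD// exprD invfM.
  rewrite mulrA ler_wpM2r ?invr_ge0 ?sqr_ge0// ler_pdivrMr ?exprn_gt0//.
  rewrite -mulrA ler_wpM2l//.
  have ss : sigma <= sigma ^+ 2 by rewrite expr2 ler_peMl ?(ltW s0)//; lra.
  have ns2 : n2 x ^+ 2 <= (2 * sigma) ^+ 2.
    by apply: lerXn2r; rewrite ?nnegrE ?mulr_ge0 ?(ltW s0).
  have : d%:R <= d%:R * sigma ^+ 2 by rewrite ler_peMr//; lra.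
  by rewrite mulrDl; move: ns2; rewrite exprMn; lra.
have main : - (m%:R * d%:R / sigma) +
    m%:R * (m%:R + 2) / 8 * (2 * d%:R + 8 * n2 x) / sigma ^+ 2 =
    (m%:R * d%:R ^+ 2 / 4 + m%:R * d%:R * b) / sigma ^+ 2.
  have nE : n2 x = sigma + b by rewrite /sigma subrK.
  by rewrite -dR nE; field; rewrite gt_eqF.
have cubic : g * (2 * d%:R + 24 * n2 x) / sigma ^+ 3 <= g * (2 * d%:R + 48) / sigma ^+ 2.
  rewrite (exprS _ 2) invfM mulrA ler_wpM2r ?invr_ge0 ?sqr_ge0// ler_pdivrMr//.
  rewrite -[leRHS]mulrA ler_wpM2l//.
  have : d%:R <= d%:R * sigma by rewrite ler_peMr//; lra.
  by rewrite mulrDl; lra.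
have quad : 0 <= (m%:R * d%:R ^+ 2 / 4 + m%:R * d%:R * b) / sigma ^+ 2 -
    g * (2 * d%:R + 48) / sigma ^+ 2 - C * (2 * d%:R + 224) / sigma ^+ 2.
  rewrite -!mulrBl; apply: mulr_ge0; last by rewrite invr_ge0 sqr_ge0.
  have md1 : 1 <= m%:R * d%:R :> R by rewrite dR; have := m1; nra.
  have md2 : 0 <= m%:R * d%:R ^+ 2 / 4 :> R by rewrite !mulr_ge0// sqr_ge0.
  have : b <= m%:R * d%:R * b by rewrite ler_peMl.
  by rewrite {1}/b; lra.
by lra.
Qed.

(** Let u, v be the square roots before and after the step, h = |x| and q = |a|. As m >= 1, the drop
    is at least u^-m (1 - u/v), where 1 - u/v = (1 + 2 q) / (v (u + v)). Then v <= 2 u <= 2 h bounds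
    the denominator by 6 h^2, and h <= d q yields 1 / (3 d h). *)
Lemma radial_drop (b : R) x i : 0 <= b -> 2 * b + 72 <= n2 x ->
  n2 x <= d%:R * a x i ^+ 2 ->
  (3 * d%:R)^-1 * Num.sqrt (n2 x) ^- d.-1 <=
  Num.sqrt (n2 x - b) ^- m - Num.sqrt (n2 x + (1 + 2 * `|a x i|) - b) ^- m.
Proof.
move=> b0 xb id; set sigma := n2 x - b; set q := `|a x i|.
have s36 : 36 <= sigma by rewrite /sigma; lra.
have s0 : 0 < sigma by lra.
have n0 : 0 < n2 x by lra.
have d1 : 1 <= d%:R :> R by rewrite dR; have := m1; lra.
have q0 : 0 <= q by exact: normr_ge0.
have qn : q ^+ 2 <= n2 x by exact: normr_coord_sqr.
have qd : n2 x <= d%:R * q ^+ 2 by rewrite /q real_normK ?num_real.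
have qs : 1 + 2 * q <= sigma / 2.
  have := sqr_ge0 (q - 8); rewrite /sigma; rewrite !expr2 in qn *; nra.
have -> : n2 x + (1 + 2 * q) - b = sigma + (1 + 2 * q) by rewrite /sigma; ring.
set u := Num.sqrt sigma; set v := Num.sqrt (sigma + _); set h := Num.sqrt (n2 x).
have u0 : 0 < u by rewrite sqrtr_gt0.
have h0 : 0 < h by rewrite sqrtr_gt0.
have v0 : 0 < v by rewrite sqrtr_gt0; lra.
have u2 : u ^+ 2 = sigma by rewrite sqr_sqrtr ?(ltW s0).
have v2 : v ^+ 2 = sigma + (1 + 2 * q) by rewrite sqr_sqrtr//; lra.
have h2 : h ^+ 2 = n2 x by rewrite sqr_sqrtr ?(ltW n0).
have uv : u <= v by rewrite ler_wsqrtr; lra.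
have uh : u <= h by rewrite ler_wsqrtr// /sigma; lra.
have v2u : v <= 2 * u.
  rewrite -(ler_pXn2r (_ : 0 < 2)%N) ?nnegrE ?(ltW v0) ?mulr_ge0 ?(ltW u0)//.
  by rewrite exprMn u2 v2; lra.
have hq : h <= d%:R * q.
  rewrite -(ler_pXn2r (_ : 0 < 2)%N) ?nnegrE ?(ltW h0) ?mulr_ge0// exprMn h2.
  by apply: (le_trans qd); rewrite ler_wpM2r ?sqr_ge0// expr2 ler_peMl.
have um : h ^- m <= u ^- m.
  by rewrite lef_pV2 ?posrE ?exprn_gt0// lerXn2r ?nnegrE ?(ltW u0) ?(ltW h0).
have vm : v ^- m <= u ^- m * (u / v).
  have -> : v ^- m = u ^- m * (u / v) ^+ m.
    by rewrite exprMn mulrA mulVf ?mul1r ?exprVn// expf_neq0// gt_eqF.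
  rewrite ler_wpM2l ?invr_ge0 ?exprn_ge0 ?(ltW u0)//.
  by rewrite ler_iXnr// ?divr_ge0 ?(ltW u0) ?(ltW v0)// ler_pdivrMr// mul1r.
apply: (@le_trans _ _ (u ^- m * (1 - u / v))); last by rewrite mulrBr mulr1 lerB.
have -> : (3 * d%:R)^-1 * h ^- d.-1 = h ^- m * (3 * d%:R * h)^-1.
  rewrite dE /= exprS !invfM; ring.
apply: ler_pM => //; rewrite ?invr_ge0 ?exprn_ge0 ?mulr_ge0 ?(ltW h0)//.
have -> : 1 - u / v = (1 + 2 * q) / (v * (u + v)).
  have -> : 1 + 2 * q = v ^+ 2 - u ^+ 2 by rewrite v2 u2; ring.
  by field; rewrite !gt_eqF// addr_gt0.
rewrite ler_pdivlMr ?mulr_gt0 ?addr_gt0// mulrC ler_pdivrMr; last first.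
  by rewrite !mulr_gt0// ltr0n dE.
have : v * (u + v) <= 6 * h ^+ 2 by rewrite !expr2; nra.
move=> /le_trans; apply; rewrite expr2.
have : 0 <= h * (d%:R * q - h) by rewrite mulr_ge0 ?subr_ge0 ?(ltW h0).
have : 0 <= d%:R * h :> R by rewrite mulr_ge0 ?(ltW h0).
by lra.
Qed.

(** The change is at most of order u^-m |t| with u = sqrt sigma and t = delta / sigma. Since |t| <=
    3 / u, this is of order u^-(d-1), and u >= k / 2 explains the power of 2. *)
Lemma radial_increment (e : R) : 6 <= e -> exists2 C : R, 0 <= C &
  forall k x p, (1 <= k)%N -> k%:R ^+ 2 <= 2 * n2 x + 2 ->
  Num.sqrt (n2 (x + unit_step p) + e) ^- m <=
  Num.sqrt (n2 x + e) ^- m + C * k%:R ^- d.-1.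
Proof.
move=> e6; have [C C0 CP] := taylor3_pow R m; have [b b0 bP] := taylor3_bound R m.
exists ((b + C) * 3 * 2 ^+ m.+1).
  by rewrite !mulr_ge0// ?exprn_ge0// addr_ge0.
move=> k x p k1 kn; set sigma := n2 x + e; have n0 : 0 <= n2 x by [].
have s6 : 6 <= sigma by rewrite /sigma; lra.
have s0 : 0 < sigma by lra.
have k0 : 0 < k%:R :> R by rewrite ltr0n.
have q2 := normr_coord_sqr x p.1.
have dp : `|delta x p| <= sigma / 2.
  apply: le_trans (delta_le x p) _.
  have := sqr_ge0 (`|a x p.1| - 2); rewrite /sigma; rewrite !expr2 in q2 *; nra.
have [w w0 [wt t2 ->]] := radial_step m erefl s0 dp.
set t := delta x p / sigma in wt t2 *; set u := Num.sqrt sigma.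
have u0 : 0 < u by rewrite sqrtr_gt0.
have u2 : u ^+ 2 = sigma by rewrite sqr_sqrtr ?(ltW s0).
have um0 : 0 <= u ^- m by rewrite invr_ge0 exprn_ge0 ?(ltW u0).
have w_le : w ^- m <= 1 + (b + C) * `|t|.
  have t4 : t ^+ 4 <= `|t|.
    rewrite -[t ^+ 4]ger0_norm ?exprn_even_ge0// normrX.
    by rewrite ler_iXnr//; lra.
  have := CP w t w0 wt t2; have := bP t t2.
  rewrite !ler_norml => /andP[_ h1] /andP[_ h2].
  have : C * t ^+ 4 <= C * `|t| by rewrite ler_wpM2l.
  by rewrite mulrDl; lra.
have t_le : `|t| <= 3 / u.
  rewrite /t normrM normfV (gtr0_norm s0) ler_pdivrMr// -u2 expr2 mulrA divfK ?gt_eqF//.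
  apply: le_trans (delta_le x p) _.
  have u1 : 1 <= u.
    by rewrite -(ler_pXn2r (_ : 0 < 2)%N) ?nnegrE ?(ltW u0)// u2 expr1n; lra.
  have : `|a x p.1| <= u.
    by rewrite -(ler_pXn2r (_ : 0 < 2)%N) ?nnegrE ?(ltW u0)// u2 /sigma; lra.
  by lra.
have uk : k%:R / 2 <= u.
  rewrite -(ler_pXn2r (_ : 0 < 2)%N) ?nnegrE ?(ltW u0) ?divr_ge0//.
  by rewrite u2 exprMn exprVn /sigma; lra.
apply: (@le_trans _ _ (u ^- m * (1 + (b + C) * (3 / u)))).
  rewrite ler_wpM2l//; apply: (le_trans w_le).
  by rewrite lerD2l ler_wpM2l// addr_ge0.
have -> : u ^- m * (1 + (b + C) * (3 / u)) = u ^- m + (b + C) * 3 * u ^- m.+1.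
  rewrite exprSr invfM; ring.
rewrite lerD2l -[leRHS]mulrA ler_wpM2l ?mulr_ge0 ?addr_ge0// dE /=.
rewrite -[2 ^+ _]invrK -invfM lef_pV2 ?posrE ?exprn_gt0 ?divr_gt0//; last first.
  by rewrite mulr_gt0 ?invr_gt0 ?exprn_gt0.
by rewrite -exprVn -exprMn mulrC; apply: lerXn2r; rewrite ?nnegrE ?(ltW u0).
Qed.

Lemma radial_vanishes (e eps : R) : 6 <= e -> 0 < eps -> exists K, forall k x,
  (K <= k)%N -> (1 <= k)%N -> k%:R ^+ 2 <= 2 * n2 x + 2 ->
  Num.sqrt (n2 x + e) ^- m <= eps.
Proof.
move=> e6 eps0; exists (Num.trunc (2 / eps)).+1 => k x Kk k1 kn.
have n0 : 0 <= n2 x by [].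
have s6 : 6 <= n2 x + e by lra.
set u := Num.sqrt _; have u0 : 0 < u by rewrite sqrtr_gt0; lra.
have u2 : u ^+ 2 = n2 x + e by rewrite sqr_sqrtr//; lra.
have u1 : 1 <= u.
  by rewrite -(ler_pXn2r (_ : 0 < 2)%N) ?nnegrE ?(ltW u0)// u2 expr1n; lra.
have uk : k%:R / 2 <= u.
  rewrite -(ler_pXn2r (_ : 0 < 2)%N) ?nnegrE ?(ltW u0) ?divr_ge0//.
  by rewrite u2 exprMn exprVn; lra.
apply: (@le_trans _ _ u^-1).
  by rewrite lef_pV2 ?posrE ?exprn_gt0// ler_eXnr.
have K2 : 2 / eps <= k%:R.
  by apply: ltW; apply: lt_le_trans (truncnS_gt _) _; rewrite ler_nat.
rewrite -[leRHS]invrK lef_pV2 ?posrE ?invr_gt0//.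
apply: le_trans uk; rewrite ler_pdivlMr// mulrC.
exact: K2.
Qed.

End HighDimension.
End RadialFunctions.

(** * Conclusions for the lattice, including the plane *)

Section LatticeDichotomy.
Variables (R : realType) (d : nat) (c : R) (N : nat -> nat).
Hypothesis d_ge2 : (2 <= d)%N.
Hypothesis c_ge1 : 1 <= c.
Hypothesis N_ge1 : forall k, (1 <= k)%N -> (1 <= N k)%N.
Variables (dT : measure_display) (T : measurableType dT).
Variables (P : probability T R) (Z : nat -> T -> 'rV[int]_d).
Hypothesis Z_egs :
  EGS (@Zd_adj d) (fun k : nat => Zd_ball (c * k%:R)) N 0 P Z.
Local Notation term k := ((N k)%:R * k%:R ^- d.-1 : R).

Let term_ge0 k : 0 <= term k.
Proof. by rewrite mulr_ge0// invr_ge0 exprn_ge0. Qed.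

Let d_gt0 : (0 < d)%N.
Proof. exact: leq_trans d_ge2. Qed.

Lemma high_dimension_as_recurrent : (2 < d)%N ->
  (\sum_(1 <= k <oo) (term k)%:E = +oo)%E -> as_recurrent 0 P Z.
Proof.
move=> d3 sumoo; pose m := d.-2.
have m0 : (0 < m)%N by rewrite /m; lia.
have dE : d = m.+2 by rewrite /m; lia.
have [b b0 sub] := radial_subharmonic R m0 dE.
pose S0 := (Num.trunc (2 * b) + 73)%N.
have S0b : 2 * b + 72 <= S0%:R.
  rewrite /S0 natrD; have := truncnS_gt (2 * b); rewrite -natr1.
  by move: (_%:R) => t; lra.
have far s : S0%:R <= s -> 0 < s - b by lra.
have le_S0 (x : 'rV[int]_d) : (2 * S0 + 2 <= sqnorm x)%N -> 2 * b + 72 <= (sqnorm x)%:R.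
  by move=> xS; apply: le_trans S0b _; rewrite ler_nat; lia.
apply: (lattice_as_recurrent d_gt0 c_ge1 N_ge1 Z_egs
  (phi := fun s => Num.sqrt (s - b) ^- m) (S0 := S0) (kappa := (3 * d%:R)^-1)) => //.
- by rewrite invr_gt0 mulr_gt0// ltr0n.
- move=> s s' Ss ss'; have ub := far _ Ss.
  have u0 : 0 < Num.sqrt (s - b) by rewrite sqrtr_gt0.
  have v0 : 0 < Num.sqrt (s' - b) by rewrite sqrtr_gt0; lra.
  rewrite lef_pV2 ?posrE ?exprn_gt0//; apply: lerXn2r; rewrite ?nnegrE ?(ltW u0) ?(ltW v0)//.
  by rewrite ler_wsqrtr// lerD2r.
- by move=> x xS; apply: sub; exact: le_S0.
- by move=> x i xS; apply: (radial_drop m0 dE b0); exact: le_S0.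
- exact: series_pinfty_partial sumoo.
Qed.

Lemma high_dimension_as_transient : (2 < d)%N ->
  (\sum_(1 <= k <oo) (term k)%:E < +oo)%E -> as_transient 0 P Z.
Proof.
move=> d3 sum_lt; pose m := d.-2.
have m0 : (0 < m)%N by rewrite /m; lia.
have dE : d = m.+2 by rewrite /m; lia.
have [e e6 super] := radial_superharmonic R m0 dE.
have [C C0 incr] := radial_increment dE e6.
apply: (lattice_as_transient d_gt0 c_ge1 N_ge1 Z_egs
  (phi := fun s => Num.sqrt (s + e) ^- m) (C := C)) => //.
- move=> s s0; rewrite invr_gt0 exprn_gt0// sqrtr_gt0; lra.
- by move=> eps eps0; exact: (radial_vanishes d m0 e6 eps0).
Qed.

End LatticeDichotomy.

(** The terms from k to 2 k - 1 sum to at least 1/2, which contradicts a tail of at most 1/4. *)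
Lemma plane_series_pinfty (R : realType) (N : nat -> nat) :
  (forall k, (1 <= k)%N -> (1 <= N k)%N) ->
  (\sum_(1 <= k <oo) ((N k)%:R * k%:R ^- 1 : R)%:E = +oo)%E.
Proof.
move=> N_ge1; apply/eqP; rewrite -leye_eq leNgt; apply/negP => sum_lt.
have [|r [r0 rS r_small]] := series_lty_tail _ sum_lt.
  by move=> k _; rewrite mulr_ge0// invr_ge0 exprn_ge0.
have [|K KP] := r_small 4^-1; first by rewrite invr_gt0.
have [k k1 Kk] : exists2 k, (1 <= k)%N & (K <= k)%N by exists K.+1.
have k0 : 0 < k%:R :> R by rewrite ltr0n.
have tail n : (n <= k)%N -> n%:R / (2 * k%:R) <= r k - r (k + n)%N.
  elim: n => [|n IH] nk; first by rewrite mul0r addn0 subrr.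
  have kn1 : (1 <= k + n)%N by exact: leq_trans (leq_addr _ _).
  have := rS _ kn1; have := IH (ltnW nk); rewrite addnS.
  rewrite -[n.+1%:R]natr1 [(_ + 1) / _]mulrDl [1 / _]mul1r.
  have : (2 * k%:R)^-1 <= (N (k + n))%:R * (k + n)%:R ^- 1 :> R.
    rewrite expr1; apply: (@le_trans _ _ ((k + n)%:R^-1)).
      rewrite lef_pV2 ?posrE ?mulr_gt0 ?ltr0n//.
      by rewrite -natrM ler_nat; lia.
    by rewrite ler_peMl ?invr_ge0// ler1n N_ge1.
  by lra.
have := tail k (leqnn k); have := KP k Kk.
have := r0 (k + k)%N (leq_trans k1 (leq_addr _ _)).
rewrite invfM mulrCA divff ?gt_eqF//; lra.
Qed.

Section Plane.
Variables (R : realType) (c : R) (N : nat -> nat).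
Hypothesis c_ge1 : 1 <= c.
Hypothesis N_ge1 : forall k, (1 <= k)%N -> (1 <= N k)%N.

Variables (dT : measure_display) (T : measurableType dT).
Variables (P : probability T R) (Z : nat -> T -> 'rV[int]_2).
Hypothesis Z_egs :
  EGS (@Zd_adj 2) (fun k : nat => Zd_ball (c * k%:R)) N 0 P Z.

(** The shift by 1 matters on the diagonals: for n = |x|^2 and coordinates of equal absolute value,
    the product of the squared norms of the four neighbors is n^4 + 2 n^2 + 1, so ln n itself is not
    superharmonic there. The constant 1/3 comes from - ln (1 - y) >= y with y = (1 + 2 q) / (n + 2
    q), where sqrt n <= 2 q. *)
Lemma plane_as_recurrent : as_recurrent 0 P Z.
Proof.
apply: (lattice_as_recurrent _ c_ge1 N_ge1 Z_egs
  (phi := fun s => - ln (s - 1)) (S0 := 2) (kappa := 3^-1)) => //.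
- move=> s s' s2 ss'; rewrite lerN2 ler_ln ?posrE; lra.
- move=> x x6; set n := (sqnorm x)%:R; have n6 : 6 <= n :> R by rewrite ler_nat.
  under [leRHS]eq_bigr do rewrite sqnorm_step -/n.
  rewrite (sum_steps x (fun t => - ln (n + t - 1))) big_ord_recl big_ord1 /=.
  have nE : n = (x ord0 ord0)%:~R ^+ 2 + (x ord0 (lift ord0 ord0))%:~R ^+ 2.
    by rewrite /n sqnormE big_ord_recl big_ord1.
  move: (_%:~R : R) (_%:~R : R) nE => A2 A1 nE.
  pose s := n - 1; have s5 : 5 <= s by rewrite /s; lra.
  have pos (B : R) : B ^+ 2 <= n -> 0 < s + 1 + 2 * B /\ 0 < s + 1 - 2 * B.
    have := sqr_ge0 (B - 2); have := sqr_ge0 (B + 2); rewrite /s !expr2; nra.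
  have [a1 b1] : 0 < s + 1 + 2 * A1 /\ 0 < s + 1 - 2 * A1.
    by apply: pos; rewrite nE lerDl sqr_ge0.
  have [a2 b2] : 0 < s + 1 + 2 * A2 /\ 0 < s + 1 - 2 * A2.
    by apply: pos; rewrite nE lerDr sqr_ge0.
  (* The sum of the logarithms over the four neighbors is the logarithm of a
     product, so superharmonicity of [ln] is a polynomial inequality. *)
  have prod : (s + 1 + 2 * A1) * (s + 1 - 2 * A1) *
      ((s + 1 + 2 * A2) * (s + 1 - 2 * A2)) <= s ^+ 4.
    have q : 4 * (A1 ^+ 2 * A2 ^+ 2) <= (s + 1) ^+ 2.
      have -> : s + 1 = A1 ^+ 2 + A2 ^+ 2 by rewrite -nE /s subrK.
      by have := sqr_ge0 (A1 ^+ 2 - A2 ^+ 2); lra.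
    have -> : (s + 1 + 2 * A1) * (s + 1 - 2 * A1) *
        ((s + 1 + 2 * A2) * (s + 1 - 2 * A2)) =
        (s + 1) ^+ 4 - 4 * (s + 1) ^+ 2 * (A1 ^+ 2 + A2 ^+ 2) + 16 * (A1 ^+ 2 * A2 ^+ 2).
      by ring.
    rewrite -nE (_ : n = s + 1); last by rewrite /s subrK.
    apply: (@le_trans _ _ ((s + 1) ^+ 4 - 4 * (s + 1) ^+ 2 * (s + 1) + 4 * (s + 1) ^+ 2)).
      by rewrite lerD2l; lra.
    have -> : (s + 1) ^+ 4 - 4 * (s + 1) ^+ 2 * (s + 1) + 4 * (s + 1) ^+ 2 =
      s ^+ 4 - 2 * s ^+ 2 + 1 by ring.
    have : 1 <= s ^+ 2 by rewrite exprn_ege1//; lra.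
    lra.
  have : ln ((s + 1 + 2 * A1) * (s + 1 - 2 * A1) *
      ((s + 1 + 2 * A2) * (s + 1 - 2 * A2))) <= ln (s ^+ 4).
    by rewrite ler_ln ?posrE ?exprn_gt0 ?mulr_gt0//; lra.
  rewrite [leRHS]lnXn; last by lra.
  rewrite !lnM ?posrE ?mulr_gt0//.
  have -> : n + (1 + 2 * A1) - 1 = s + 1 + 2 * A1 by rewrite /s; ring.
  have -> : n + (1 - 2 * A1) - 1 = s + 1 - 2 * A1 by rewrite /s; ring.
  have -> : n + (1 + 2 * A2) - 1 = s + 1 + 2 * A2 by rewrite /s; ring.
  have -> : n + (1 - 2 * A2) - 1 = s + 1 - 2 * A2 by rewrite /s; ring.
  by rewrite -/s -[ln s *+ 4]mulr_natl; lra.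
- move=> x i x6; set n := (sqnorm x)%:R; have n6 : 6 <= n :> R by rewrite ler_nat.
  set q := `|_|; have q0 : 0 <= q by exact: normr_ge0.
  rewrite -[_ ^+ 2]real_normK ?num_real// -/q expr1 => nq.
  have qn : q ^+ 2 <= n by exact: normr_coord_sqr.
  pose y := (1 + 2 * q) / (n + 2 * q).
  have nq0 : 0 < n + 2 * q by lra.
  apply: (@le_trans _ _ y); last first.
    have yE : 1 - y = (n - 1) / (n + 2 * q).
      by rewrite /y; field; rewrite gt_eqF.
    have := @le_ln1Dx R (- y); rewrite yE => h.
    have {}h : ln ((n - 1) / (n + 2 * q)) <= - y.
      apply: h; rewrite ltrNl opprK /y ltr_pdivrMr//; lra.
    move: h; rewrite ln_div ?posrE//; last by lra.
    have -> : n + (1 + 2 * q) - 1 = n + 2 * q by ring.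
    lra.
  pose h := Num.sqrt n; have h0 : 0 < h by rewrite sqrtr_gt0; lra.
  have h2 : h ^+ 2 = n by rewrite sqr_sqrtr//; lra.
  have hq : h <= 2 * q.
    rewrite -(ler_pXn2r (_ : 0 < 2)%N) ?nnegrE ?(ltW h0) ?mulr_ge0//.
    by rewrite h2 exprMn; lra.
  rewrite -/h -invfM /y ler_pdivlMr// mulrC ler_pdivrMr ?mulr_gt0//.
  have := sqr_ge0 (q - 1); rewrite !expr2 in h2 qn *; nra.
- apply: series_pinfty_partial; last exact: (plane_series_pinfty R N_ge1).
  by move=> k _; rewrite mulr_ge0// invr_ge0 exprn_ge0.
Qed.

End Plane.

Lemma as_transient_recurrent (R : realType) (V : Type) (o : V)
    (d : measure_display) (T : measurableType d) (P : probability T R)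
    (Z : nat -> T -> V) : as_transient o P Z -> as_recurrent o P Z -> False.
Proof.
move=> tr re; have := negligibleU tr re.
rewrite (_ : _ `|` _ = setT); last first.
  apply/seteqP; split => // w _ /=.
  by have [?|?] := pselect (recurrent_path o (Z ^~ w)); [left; apply|right].
move=> /(negligibleP P measurableT) PT0; have : P setT = 0%E := PT0.
by rewrite probability_setT => /eqP; rewrite eqe oner_eq0.
Qed.

Theorem proposition1p12 (R : realType) (c : R) (N : nat -> nat)
    (c_ge1 : 1 <= c) (N_ge1 : forall k : nat, (1 <= k)%N -> (1 <= N k)%N) :
  (forall (V : choiceType) (e : rel V) (o : V)
      (e_sym : symmetric e) (e_irr : irreflexive e)
      (V_inf : infinite_set [set: V])
      (e_conn : graph_connected e) (e_deg : bounded_degrees e)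
      (dW : measure_display) (TW : measurableType dW)
      (PW : V -> probability TW R) (W : nat -> TW -> V)
      (W_srw : forall x : V, simple_random_walk e x (PW x) W)
      (dT : measure_display) (T : measurableType dT)
      (P : probability T R) (Z : nat -> T -> V)
      (Z_egs : EGS e (egs_ball e o c) N o P Z),
    ((\sum_(1 <= k <oo) ((N k)%:R%:E *
        ereal_inf
          [set PW x [set w | hits_before o
                (graph_boundary e (egs_ball e o c k)) (W ^~ w)]
          | x in inner_shell e o c k]))%E = +oo%E ->
      as_recurrent o P Z) /\
    ((\sum_(1 <= k <oo) ((N k)%:R%:E *
        ereal_sup
          [set PW x [set w | hits_before o
                (graph_boundary e (egs_ball e o c k.+1)) (W ^~ w)]
          | x in inner_shell e o c k]) < +oo)%E ->
      as_transient o P Z)) /\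
  (forall (d : nat) (d_ge2 : (2 <= d)%N)
      (dT : measure_display) (T : measurableType dT)
      (P : probability T R) (Z : nat -> T -> 'rV[int]_d)
      (Z_egs : EGS (@Zd_adj d) (fun k : nat => Zd_ball (c * k%:R)) N 0 P Z),
    [/\ as_transient 0 P Z \/ as_recurrent 0 P Z,
        as_transient 0 P Z <->
          (\sum_(1 <= k <oo) ((N k)%:R * k%:R ^ (1 - d%:Z) : R)%:E < +oo)%E &
        (\sum_(1 <= k <oo) ((N k)%:R * k%:R ^ (1 - d%:Z) : R)%:E)%E = +oo%E ->
          as_recurrent 0 P Z]).
Proof.
split=> [V e o e_sym _ V_inf e_conn e_deg dW TW PW W W_srw dT T P Z Z_egs|
  d d_ge2 dT T P Z Z_egs].
  split=> [sumoo|sum_lt].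
    exact: (graph_as_recurrent c_ge1 N_ge1 e_sym V_inf e_conn e_deg W_srw Z_egs).
  exact: (graph_as_transient c_ge1 N_ge1 e_sym V_inf e_conn e_deg W_srw Z_egs).
have termE : (\sum_(1 <= k <oo) ((N k)%:R * k%:R ^ (1 - d%:Z) : R)%:E)%E =
    (\sum_(1 <= k <oo) ((N k)%:R * k%:R ^- d.-1 : R)%:E)%E.
  apply: eq_eseries_from => k _; congr (_ * _)%:E.
  rewrite -(prednK (ltnW d_ge2)) intS opprD addNKr /=.
  by rewrite -exprnN.
rewrite termE; set S := (\sum_(1 <= k <oo) _)%E.
have recur : S = +oo%E -> as_recurrent 0 P Z.
  move: (d_ge2); rewrite leq_eqVlt => /predU1P[d2|d3] Soo.
    by subst d; exact: (plane_as_recurrent c_ge1 N_ge1 Z_egs).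
  exact: (high_dimension_as_recurrent d_ge2 c_ge1 N_ge1 Z_egs).
have trans : (S < +oo)%E -> as_transient 0 P Z.
  move=> S_lt; apply: (high_dimension_as_transient d_ge2 c_ge1 N_ge1 Z_egs) => //.
  rewrite ltn_neqAle d_ge2 andbT; apply: contraTneq S_lt => d2.
  by rewrite /S -d2 plane_series_pinfty// ltxx.
have [S_lt|S_ge] := ltP S +oo%E.
  split; first by left; exact: trans.
    by split=> // _; exact: trans.
  exact: recur.
have Soo : S = +oo%E by apply/eqP; rewrite -leye_eq.
split; first by right; exact: recur.
  split=> [tr|//].
  by case: (as_transient_recurrent tr (recur Soo)).
exact: recur.
Qed.
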